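(* Let $G(s)$ be an $m\times m$ real-rational proper negative imaginary transfer function matrix and let $H(s)$ be an $m\times m$ real-rational proper strictly negative imaginary transfer function matrix, such that $G(\infty)H(\infty)=0$ and $H(\infty)\geq 0$. Assume also that $\lambda_{\max}(G(0)H(0))<1$. Then the positive feedback interconnection of $G(s)$ and $H(s)$ is internally stable.
   Context: For Hermitian matrices, $X\ge 0$ (resp. $X>0$) means positive semidefinite (resp. positive definite); $X^{*}$ is the conjugate transpose; $j=\sqrt{-1}$; $G(\infty)=\lim_{s\to\infty}G(s)$. $\lambda_{\max}(\cdot)$ denotes the maximum eigenvalue of a matrix with only real eigenvalues. Negative imaginary (NI): a square transfer function matrix $G(s)$ is NI if (1) $G(s)$ has no pole at the origin and no pole in $\operatorname{Re}[s]>0$; (2) for all $\omega>0$ such that $j\omega$ is not a pole of $G(s)$, $j\left(G(j\omega)-G(j\omega)^{*}\right)\ge 0$; (3) if $j\omega_0$, with $\omega_0\in(0,\infty)$, is a pole of $G(s)$, then it is at most a simple pole and the matrix $K_0=\lim_{s\to j\omega_0}(s-j\omega_0)\,s\,G(s)$ is positive semidefinite Hermitian. Strictly negative imaginary (SNI): a square real-rational transfer function matrix $H(s)$ is SNI if (1) $H(s)$ has no poles in $\operatorname{Re}[s]\ge 0$; (2) $j\left[H(j\omega)-H(j\omega)^{*}\right]>0$ for all $\omega\in(0,\infty)$. Positive feedback interconnection and internal stability: let $(A_1,B_1,C_1,D_1)$ and $(A_2,B_2,C_2,D_2)$ be minimal real state-space realizations of $G(s)$ and $H(s)$ respectively, i.e.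 $\dot x_i=A_ix_i+B_iu_i$, $y_i=C_ix_i+D_iu_i$ for $i=1,2$. The positive feedback interconnection is obtained by setting $u_1=y_2$ and $u_2=y_1$. When $G(\infty)H(\infty)=D_1D_2=0$ (so that also $D_2D_1=0$, since $D_1,D_2$ are symmetric for NI and SNI systems), the closed-loop system is $\dot x=\breve A x$ with $x=(x_1,x_2)$ and $$\breve A=\begin{bmatrix} A_1+B_1D_2C_1 & B_1C_2\\ B_2C_1 & A_2+B_2D_1C_2\end{bmatrix}.$$ The interconnection is internally stable if all eigenvalues of $\breve A$ lie in the open left half plane. *)

(* Defs.v *)
From HB Require Import structures.
From mathcomp Require Import all_boot all_order all_algebra.
From mathcomp Require Import all_classical all_reals topology normedtype.
From mathcomp Require Import complex.

Set Implicit Arguments.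
Unset Strict Implicit.
Unset Printing Implicit Defensive.

Import Order.TTheory GRing.Theory Num.Theory.
Import numFieldNormedType.Exports.

Local Open Scope ring_scope.
Local Open Scope classical_set_scope.
Local Open Scope complex_scope.
Local Open Scope sesquilinear_scope.

(* R[i] with the topology of its modulus; the library only equips the regular
   module R[i]^o with it. *)
#[warnings="-redundant-canonical-projection"]
HB.instance Definition _ (R : rcfType) := NormedModule.copy R[i] R[i]^o.

(* Real-rational functions of s, the variable s being 'X, and m x m transfer
   function matrices. *)
Notation ratfun R := {fraction {poly R}}.
Notation tfmx R m := 'M[ratfun R]_m.

Section RationalFunctions.
Variable R : rcfType.
Implicit Types (f : ratfun R) (s : R[i]).

(* [repr f] is an arbitrary pair representing f, so common factors have to be
   cancelled before one can read off poles, values and degrees. *)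
Definition rnum f : {poly R} :=
  let x := generic_quotient.repr f in \n_x %/ gcdp \n_x \d_x.
Definition rden f : {poly R} :=
  let x := generic_quotient.repr f in \d_x %/ gcdp \n_x \d_x.

Definition polyRC (p : {poly R}) : {poly R[i]} := map_poly (real_complex R) p.

(* Meaningful only when s is not a pole of f. *)
Definition reval f s : R[i] := (polyRC (rnum f)).[s] / (polyRC (rden f)).[s].

Definition pole_order f s : nat := mup s (polyRC (rden f)).

Definition rproper f : Prop := (size (rnum f) <= size (rden f))%N.

End RationalFunctions.

(* The filter of neighbourhoods of the point at infinity of the complex plane. *)
Definition cinfty (R : rcfType) : set_system R[i] :=
  [set P | exists M : R, forall s : R[i], M%:C < `|s| -> P s].

#[global] Instance cinfty_proper_filter (R : rcfType) :
  ProperFilter (@cinfty R).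
Proof.
split.
  move=> [M /(_ ((`|M| + 1)%:C))]; apply.
  have M1 : 0 <= `|M| + 1 :> R by rewrite addr_ge0.
  rewrite ger0_norm ?lecR// ltcR.
  by rewrite (le_lt_trans (ler_norm M))// ltrDl.
split.
- by exists 0.
- move=> P Q [M MP] [N NQ]; exists (Num.max M N) => s Hs; split.
    by apply: MP; apply: le_lt_trans Hs; rewrite lecR le_max lexx.
  by apply: NQ; apply: le_lt_trans Hs; rewrite lecR le_max lexx orbT.
- by move=> P Q PQ [M MP]; exists M => s /MP; exact: PQ.
Qed.

Section HermitianMatrices.
Variables (R : rcfType) (n : nat).
Implicit Type M : 'M[R[i]]_n.

(* In the order of R[i], [0 <= z] and [0 < z] entail that z is real. *)
Definition psdmx M : Prop :=
  M \is hermsymmx /\ forall v : 'cV[R[i]]_n, 0 <= (v ^t* *m M *m v) 0 0.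

Definition pdmx M : Prop :=
  M \is hermsymmx /\
  forall v : 'cV[R[i]]_n, v != 0 -> 0 < (v ^t* *m M *m v) 0 0.

End HermitianMatrices.

(* Intended for matrices all of whose eigenvalues are real; the supremum of a
   finite nonempty set of reals is its maximum. *)
Definition lambda_max (R : realType) (n : nat) (M : 'M[R[i]]_n) : R :=
  sup [set x : R | eigenvalue M x%:C].

Section TransferFunctions.
Variables (R : rcfType) (m : nat).
Implicit Type G : tfmx R m.

Definition tfproper G : Prop := forall i j, rproper (G i j).

Definition tfeval G (s : R[i]) : 'M[R[i]]_m := \matrix_(i, j) reval (G i j) s.

Definition tfinfty G : 'M[R[i]]_m := lim (tfeval G s @[s --> @cinfty R]).

Definition tfpole G (s : R[i]) : Prop :=
  exists i j, (0 < pole_order (G i j) s)%N.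

Definition tfpole_simple G (s : R[i]) : Prop :=
  tfpole G s /\ forall i j, (pole_order (G i j) s <= 1)%N.

Definition jw (w : R) : R[i] := 0 +i* w.

Definition jdiff G (w : R) : 'M[R[i]]_m :=
  'i *: (tfeval G (jw w) - (tfeval G (jw w)) ^t*).

Definition negative_imaginary G : Prop :=
  [/\ ~ tfpole G 0 /\ (forall s : R[i], 0 < complex.Re s -> ~ tfpole G s),
      forall w : R, 0 < w -> ~ tfpole G (jw w) -> psdmx (jdiff G w)
    & forall w : R, 0 < w -> tfpole G (jw w) ->
        tfpole_simple G (jw w) /\
        psdmx (lim (((s - jw w) * s) *: tfeval G s @[s --> (jw w)^']))].

Definition strictly_negative_imaginary G : Prop :=
  (forall s : R[i], 0 <= complex.Re s -> ~ tfpole G s) /\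
  (forall w : R, 0 < w -> pdmx (jdiff G w)).

End TransferFunctions.

Record state_space (R : rcfType) (n m : nat) := StateSpace {
  ssA : 'M[R]_n; ssB : 'M[R]_(n, m); ssC : 'M[R]_(m, n); ssD : 'M[R]_m }.

Section Realizations.
Variables (R : rcfType) (m : nat).

Definition ratC (c : R) : ratfun R := @FracField.tofrac {poly R} c%:P.

(* C (sI - A)^-1 B + D; [char_poly_mx A] is the polynomial matrix sI - A. *)
Definition transfer (n : nat) (S : state_space R n m) : tfmx R m :=
  map_mx ratC (ssC S)
    *m invmx (map_mx (@FracField.tofrac {poly R}) (char_poly_mx (ssA S)))
    *m map_mx ratC (ssB S)
  + map_mx ratC (ssD S).

Definition minimal_realization (G : tfmx R m) (n : nat)
    (S : state_space R n m) : Prop :=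
  transfer S = G /\
  forall (n' : nat) (S' : state_space R n' m), transfer S' = G -> (n <= n')%N.

(* State matrix of the interconnection u1 = y2, u2 = y1, for systems with
   D1 D2 = D2 D1 = 0 (otherwise the inverses of 1 - D1 D2 and 1 - D2 D1 would
   enter). *)
Definition closed_loop (n1 n2 : nat) (S1 : state_space R n1 m)
    (S2 : state_space R n2 m) : 'M[R]_(n1 + n2) :=
  block_mx (ssA S1 + ssB S1 *m ssD S2 *m ssC S1) (ssB S1 *m ssC S2)
           (ssB S2 *m ssC S1) (ssA S2 + ssB S2 *m ssD S1 *m ssC S2).

Definition hurwitz (n : nat) (A : 'M[R]_n) : Prop :=
  forall l : R[i], eigenvalue (map_mx (real_complex R) A) l ->
    complex.Re l < 0.

(* Two minimal realizations of the same G are similar, so the choice of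
   realizations is immaterial. *)
Definition internally_stable (G H : tfmx R m) : Prop :=
  forall (n1 n2 : nat) (S1 : state_space R n1 m) (S2 : state_space R n2 m),
    minimal_realization G S1 -> minimal_realization H S2 ->
    hurwitz (closed_loop S1 S2).

End Realizations.

(* Main.v *)
(* Replace H by t H with t in (0, 1]: the closed-loop matrix becomes an affine
   pencil A(t), which for t = 0 has the eigenvalues of the two open-loop systems.
   A(t) has no eigenvalue on the imaginary axis. At jw with w > 0 the loop
   signals satisfy u2 = G u1, u1 = t H u2, so Im (u1* u2) would be both <= 0 (G is
   negative imaginary) and > 0 (H is strictly so); when jw is a pole of G,
   its residue K satisfies K u1 = 0 and u1* K = 0, and by minimality u1* kills the
   whole polar part, so that the regular part of G can be used instead. At 0 the
   number 1/t >= 1 would be an eigenvalue of G(0) H(0). For small t the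
   eigenvalues leaving a pole of G on the imaginary axis move into the closed left
   half plane because the residue is semidefinite. Continuity of the
   spectrum in t then carries stability from small t to t = 1. *)

Require Import Defs.
From mathcomp Require Import all_boot all_order all_algebra.
From mathcomp Require Import all_classical all_reals topology normedtype.
From mathcomp Require Import complex ring lra.

Set Implicit Arguments.
Unset Strict Implicit.
Unset Printing Implicit Defensive.

Import Order.TTheory GRing.Theory Num.Theory.
Import numFieldNormedType.Exports.

Local Open Scope ring_scope.
Local Open Scope classical_set_scope.
Local Open Scope complex_scope.
Local Open Scope sesquilinear_scope.

(** * Matrix norm and perturbation of eigenvalues *)

(** Two obstacles shape the proof. First, the spectrum has to be followed in t without counting or
    labelling eigenvalues. Two one-sided facts suffice: an eigenvalue of a slightly perturbed matrix
    is close to some eigenvalue of the original one, and |det (z - A)| >= r^n when z is at distance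
    at least r from the spectrum. The former starts stability at small t and prolongs it to the
    right; the latter shows that stability survives at the supremum. A(0) itself need not be stable,
    so the start rests on local estimates near each of its eigenvalues. Second, the hypotheses speak
    of the poles of G, the argument of the resolvent of A1. Minimality is the bridge: an A-invariant
    space of row vectors that contains the rows of C is the whole space. Applied to a divisibility
    condition, this bounds the pole order of the resolvent by that of G. At a simple pole two
    constant matrices P and T then replace the Laurent expansion, and limits become explicit norm
    inequalities. *)

Section ComplexModulus.
Variable R : rcfType.
Implicit Types z w : R[i].

(** The norm of [R[i]] has values in [R[i]], whose order is partial; estimates are made in the
    ordered field [R], where [lra] and [nra] apply. *)
Definition cmod z : R := complex.Re `|z|.

Lemma cmodE z : `|z| = (cmod z)%:C.
Proof. by rewrite RRe_real// normr_real. Qed.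

Lemma cmod_ge0 z : 0 <= cmod z.
Proof. by rewrite -ler0c -cmodE. Qed.

Lemma cmodM z w : cmod (z * w) = cmod z * cmod w.
Proof. by apply: complexI; rewrite rmorphM /= -!cmodE normrM. Qed.

Lemma cmodD z w : cmod (z + w) <= cmod z + cmod w.
Proof. by rewrite -lecR rmorphD /= -!cmodE ler_normD. Qed.

Lemma cmodN z : cmod (- z) = cmod z.
Proof. by rewrite /cmod normrN. Qed.

Lemma cmod0 : cmod 0 = 0.
Proof. by rewrite /cmod normr0. Qed.

Lemma cmod1 : cmod 1 = 1.
Proof. by rewrite /cmod normr1. Qed.

Lemma cmod_eq0 z : (cmod z == 0) = (z == 0).
Proof. by rewrite -(inj_eq (@complexI R)) -cmodE normr_eq0. Qed.

Lemma cmod_conj z : cmod z^* = cmod z.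
Proof. by rewrite /cmod normcJ. Qed.

Lemma cmod_real (x : R) : cmod x%:C = `|x|.
Proof. by rewrite /cmod normc_def /= expr0n /= addr0 sqrtr_sqr. Qed.

Lemma cmod_sqr z : cmod z ^+ 2 = complex.Re z ^+ 2 + complex.Im z ^+ 2.
Proof.
by rewrite /cmod normc_def /= sqr_sqrtr// addr_ge0// sqr_ge0.
Qed.

Lemma Re_le_cmod z : `|complex.Re z| <= cmod z.
Proof. by rewrite -lecR -cmodE normc_ge_Re. Qed.

Lemma Im_le_cmod z : `|complex.Im z| <= cmod z.
Proof.
have -> : complex.Im z = - complex.Re (z * 'i) by rewrite ReiNIm opprK.
rewrite normrN (le_trans (Re_le_cmod _))// cmodM.
by rewrite [X in _ * X](_ : _ = 1) ?mulr1// /cmod normc_def /= expr0n /= add0r expr1n sqrtr1.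
Qed.

Lemma cmod_sum (I : finType) (F : I -> R[i]) :
  cmod (\sum_i F i) <= \sum_i cmod (F i).
Proof.
elim/big_ind2: _ => [|x a y b xa yb|//]; first by rewrite cmod0.
by rewrite (le_trans (cmodD _ _))// lerD.
Qed.

Lemma cmod_prod (I : eqType) (s : seq I) (F : I -> R[i]) :
  cmod (\prod_(i <- s) F i) = \prod_(i <- s) cmod (F i).
Proof. by elim/big_ind2: _ => [|x a y b <- <-|//]; rewrite ?cmod1 ?cmodM. Qed.

Lemma conjCE z : Num.conj z = z^*.
Proof. by []. Qed.

End ComplexModulus.

Section MatrixNorm.
Variable R : rcfType.

(** The entrywise l1 norm: submultiplicative, invariant under conjugate transposition, and available
    for all sizes, empty ones included. *)
Definition mxn m n (M : 'M[R[i]]_(m, n)) : R := \sum_i \sum_j cmod (M i j).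

Lemma mxn_ge0 m n (M : 'M_(m, n)) : 0 <= mxn M.
Proof. by apply: sumr_ge0 => i _; apply: sumr_ge0 => j _; exact: cmod_ge0. Qed.

Lemma mxn_entry m n (M : 'M_(m, n)) i j : cmod (M i j) <= mxn M.
Proof.
rewrite /mxn (bigD1 i)//= (bigD1 j)//= -addrA lerDl addr_ge0//.
  by apply: sumr_ge0 => k _; exact: cmod_ge0.
by apply: sumr_ge0 => k _; apply: sumr_ge0 => l _; exact: cmod_ge0.
Qed.

Lemma mxn0 m n : mxn (0 : 'M_(m, n)) = 0.
Proof. by rewrite /mxn big1// => i _; rewrite big1// => j _; rewrite mxE cmod0. Qed.

Lemma mxn_eq0 m n (M : 'M_(m, n)) : (mxn M == 0) = (M == 0).
Proof.
apply/eqP/eqP => [M0|->]; last exact: mxn0.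
apply/matrixP => i j; rewrite mxE; apply/eqP; rewrite -cmod_eq0 eq_le cmod_ge0.
by rewrite -M0 mxn_entry.
Qed.

Lemma mxn_gt0 m n (M : 'M_(m, n)) : (0 < mxn M) = (M != 0).
Proof. by rewrite lt_def mxn_ge0 mxn_eq0 andbT. Qed.

Lemma mxnD m n (M N : 'M_(m, n)) : mxn (M + N) <= mxn M + mxn N.
Proof.
rewrite /mxn -big_split /=; apply: ler_sum => i _; rewrite -big_split /=.
by apply: ler_sum => j _; rewrite mxE cmodD.
Qed.

Lemma mxnN m n (M : 'M_(m, n)) : mxn (- M) = mxn M.
Proof. by apply: eq_bigr => i _; apply: eq_bigr => j _; rewrite mxE cmodN. Qed.

Lemma mxnB m n (M N : 'M_(m, n)) : mxn (M - N) <= mxn M + mxn N.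
Proof. by rewrite (le_trans (mxnD _ _))// mxnN. Qed.

Lemma mxnZ m n a (M : 'M_(m, n)) : mxn (a *: M) = cmod a * mxn M.
Proof.
rewrite /mxn big_distrr; apply: eq_bigr => i _; rewrite big_distrr.
by apply: eq_bigr => j _; rewrite mxE cmodM.
Qed.

Lemma mxnM m n p (M : 'M_(m, n)) (N : 'M_(n, p)) : mxn (M *m N) <= mxn M * mxn N.
Proof.
rewrite /mxn big_distrl /=; apply: ler_sum => i _.
apply: (@le_trans _ _ (\sum_k \sum_j cmod (M i j) * cmod (N j k))).
  apply: ler_sum => k _; rewrite mxE (le_trans (cmod_sum _))//.
  by apply: ler_sum => j _; rewrite cmodM.
rewrite exchange_big /= big_distrl /=; apply: ler_sum => j _.
rewrite -big_distrr /= ler_wpM2l ?cmod_ge0//.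
rewrite (bigD1 j (P := predT))//= lerDl.
by apply: sumr_ge0 => k _; apply: sumr_ge0 => l _; exact: cmod_ge0.
Qed.

Lemma mxn_adj m n (M : 'M_(m, n)) : mxn (M ^t*) = mxn M.
Proof.
rewrite /mxn exchange_big; apply: eq_bigr => i _; apply: eq_bigr => j _.
by rewrite !mxE cmod_conj.
Qed.

Lemma mxn_scalar n (M : 'M_n) x a : M *m x = a *: x -> x != 0 :> 'cV_n -> cmod a <= mxn M.
Proof.
move=> Mx x0; rewrite -(@ler_pM2r _ (mxn x)) ?mxn_gt0//.
by rewrite -mxnZ -Mx mxnM.
Qed.

End MatrixNorm.

(** Induction along Horner's scheme gives the bound without compactness of the disc. *)
Lemma horner_bound (R : rcfType) (p : {poly R[i]}) (B : R) :
  exists2 K : R, 0 < K & forall z, cmod z <= B -> cmod p.[z] <= K.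
Proof.
elim/poly_ind: p => [|p c [K K0 HK]].
  by exists 1 => // z _; rewrite horner0 cmod0.
exists (K * `|B| + cmod c + 1); first by rewrite ltr_wpDl// addr_ge0 ?cmod_ge0// mulr_ge0// ltW.
move=> z zB; rewrite hornerMXaddC (le_trans (cmodD _ _))//.
rewrite -addrA lerD// ?lerDl// cmodM ler_pM ?cmod_ge0// ?HK//.
by rewrite (le_trans zB)// ler_norm.
Qed.

Lemma hornermx_bound (R : rcfType) m n (M : 'M[{poly R[i]}]_(m, n)) (B : R) :
  exists2 K : R, 0 < K &
    forall z, cmod z <= B -> mxn (map_mx (horner_eval z) M) <= K.
Proof.
pose K i j := projT1 (cid2 (horner_bound (M i j) B)).
have HK i j z : cmod z <= B -> cmod (M i j).[z] <= K i j.
  by rewrite /K; case: cid2 => /= k _; apply.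
have K0 i j : 0 <= K i j by rewrite /K; case: cid2 => /= k /ltW.
exists (\sum_i \sum_j K i j + 1).
  by rewrite ltr_wpDl// sumr_ge0// => i _; rewrite sumr_ge0.
move=> z zB; rewrite (@le_trans _ _ (\sum_i \sum_j K i j)) ?lerDl//.
by apply: ler_sum => i _; apply: ler_sum => j _; rewrite mxE /= /horner_eval HK.
Qed.

Section Eigenvalues.
Variable R : rcfType.
Local Notation C := R[i].

Lemma char_poly_tr (F : comNzRingType) n (M : 'M[F]_n) : char_poly M^T = char_poly M.
Proof.
rewrite /char_poly -[RHS]det_tr /char_poly_mx; congr (\det _).
by rewrite linearB /= tr_scalar_mx map_trmx.
Qed.

(** [eigenvalue] is about row vectors; states and signals are columns, hence the detour through the
    transpose. *)
Lemma char_poly_root_col (F : fieldType) n (M : 'M[F]_n) l :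
  reflect (exists2 x : 'cV_n, x != 0 & M *m x = l *: x) (root (char_poly M) l).
Proof.
rewrite -char_poly_tr -eigenvalue_root_char; apply: (iffP eigenvalueP) => -[x Ex x0].
  exists x^T; first by rewrite trmx_eq0.
  by apply: trmx_inj; rewrite trmx_mul trmxK Ex linearZ /= trmxK.
by exists x^T; rewrite ?trmx_eq0// -trmx_mul x0 linearZ.
Qed.

Lemma char_poly_eval (F : comNzRingType) n (M : 'M[F]_n) z :
  (char_poly M).[z] = \det (z%:M - M).
Proof.
have -> : (char_poly M).[z] = horner_eval z (char_poly M) by [].
rewrite -det_map_mx; congr (\det _); apply/matrixP => i j.
by rewrite !mxE /= /horner_eval hornerD hornerN hornerMn hornerX hornerC.
Qed.

Lemma char_poly_mx_eval (F : comNzRingType) n (M : 'M[F]_n) z :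
  map_mx (horner_eval z) (char_poly_mx M) = z%:M - M.
Proof.
apply/matrixP => i j.
by rewrite !mxE /= /horner_eval hornerD hornerN hornerMn hornerX hornerC.
Qed.

Lemma char_poly_factor n (M : 'M[C]_n) :
  exists2 s : seq C, size s = n & char_poly M = \prod_(a <- s) ('X - a%:P).
Proof.
have [s Es] := closed_field_poly_normal (char_poly M).
move: Es; rewrite (monicP (char_poly_monic M)) scale1r => Es; exists s => //.
by apply: succn_inj; rewrite -(size_char_poly M) Es size_prod_XsubC.
Qed.

(** The determinant is a product of n factors z - a over the roots a. *)
Lemma char_poly_lower n (M : 'M[C]_n) z (e : R) : 0 <= e ->
  (forall a, root (char_poly M) a -> e <= cmod (z - a)) ->
  e ^+ n <= cmod (\det (z%:M - M)).
Proof.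
move=> e0; have [s sz Es] := char_poly_factor M.
rewrite -char_poly_eval Es -sz => H.
have {}H a : a \in s -> e <= cmod (z - a) by move=> sa; apply: H; rewrite root_prod_XsubC.
rewrite horner_prod cmod_prod; elim: s H {sz Es} => [|a s IH] H; first by rewrite big_nil expr0.
rewrite big_cons exprS ler_pM ?exprn_ge0//.
  by rewrite hornerXsubC H// mem_head.
by apply: IH => b sb; rewrite H// inE sb orbT.
Qed.

(** If (M + E) x = z x, then (z - M) x = E x, and the adjugate gives det (z - M) x = adj (z - M) E
    x. So |det (z - M)| is at most a constant times |E|, whereas it is at least e^n when z keeps
    distance e from the spectrum. *)
Lemma eigenvalue_perturb n (M : 'M[C]_n) (e : R) : 0 < e ->
  exists2 d : R, 0 < d & forall E : 'M[C]_n, mxn E < d ->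
    forall z, root (char_poly (M + E)) z ->
      exists2 a, root (char_poly M) a & cmod (z - a) < e.
Proof.
move=> e0.
have [K K0 HK] := hornermx_bound (\adj (char_poly_mx M)) (mxn M + 1).
(* The bound 1 keeps z in the disc of radius [mxn M + 1], on which [K] bounds the adjugate. *)
exists (Num.min 1 (e ^+ n / K)); first by rewrite lt_min ltr01 divr_gt0// exprn_gt0.
move=> E; rewrite lt_min => /andP[E1 EK] z /char_poly_root_col[x x0 Ex].
apply: contrapT => H.
have {}H a : root (char_poly M) a -> e <= cmod (z - a).
  by move=> ra; rewrite leNgt; apply/negP => la; apply: H; exists a.
have zB : cmod z <= mxn M + 1.
  rewrite (le_trans (mxn_scalar Ex x0))// (le_trans (mxnD _ _))//.
  by rewrite lerD2l ltW.
have xE : (z%:M - M) *m x = E *m x.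
  by rewrite mulmxBl mul_scalar_mx -Ex mulmxDl addrC addKr.
have := HK z zB; rewrite map_mx_adj char_poly_mx_eval => Kadj.
have : \det (z%:M - M) *: x = \adj (z%:M - M) *m (E *m x).
  by rewrite -xE mulmxA mul_adj_mx mul_scalar_mx.
move=> /(congr1 (@mxn _ _ _)); rewrite mxnZ => Hx.
have x1 : 0 < mxn x by rewrite mxn_gt0.
have := char_poly_lower (ltW e0) H.
rewrite -(ler_pM2r x1) Hx leNgt => /negP; apply.
rewrite (le_lt_trans (mxnM _ _))// (@le_lt_trans _ _ (K * (mxn E * mxn x)))//.
  by rewrite ler_pM ?mxn_ge0// mxnM.
by rewrite mulrA ltr_pM2r// mulrC -ltr_pdivlMr.
Qed.

(** The determinant is a polynomial in t with root t0; the cofactor of ['X - t0] is bounded near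
    t0. *)
Lemma det_pencil_cont n (M E : 'M[C]_n) (t0 e : R) : 0 < e ->
  \det (M + t0%:C *: E) = 0 ->
  exists2 d : R, 0 < d & forall t : R, `|t - t0| < d ->
    cmod (\det (M + t%:C *: E)) < e.
Proof.
move=> e0 D0; pose q := \det (map_mx polyC M + 'X *: map_mx polyC E).
have Hq (t : C) : q.[t] = \det (M + t *: E).
  rewrite -[q.[t]]/(horner_eval t q) -det_map_mx; congr (\det _); apply/matrixP => i j.
  by rewrite !mxE /= /horner_eval hornerD hornerM hornerX !hornerC.
have /factor_theorem[q1 Eq] : root q t0%:C by rewrite /root Hq D0.
have [K K0 HK] := horner_bound q1 (`|t0| + 1).
exists (Num.min 1 (e / K)); first by rewrite lt_min ltr01 divr_gt0.
move=> t; rewrite lt_min => /andP[t1 tK]; rewrite -Hq Eq hornerM hornerXsubC cmodM.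
rewrite -rmorphB /= cmod_real (@le_lt_trans _ _ (K * `|t - t0|))//.
  rewrite ler_wpM2r// HK// cmod_real -[t](subrK t0) (le_trans (ler_normD _ _))//.
  by rewrite addrC lerD2l ltW.
by rewrite mulrC -ltr_pdivlMr.
Qed.

End Eigenvalues.

(** * Stability along a pencil without imaginary eigenvalues *)

Section Homotopy.
Variable R : realType.

(** The spectrum is finite, so the least of the radii serves all eigenvalues. *)
Lemma root_uniform n (M : 'M[R[i]]_n) (P : R[i] -> R -> Prop) :
  (forall a d d', d' <= d -> P a d -> P a d') ->
  (forall a, root (char_poly M) a -> exists2 d : R, 0 < d & P a d) ->
  exists2 d : R, 0 < d & forall a, root (char_poly M) a -> P a d.
Proof.
move=> Pmon; have [s _ ->] := char_poly_factor M => H.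
have {}H a : a \in s -> exists2 d : R, 0 < d & P a d.
  by move=> sa; apply: H; rewrite root_prod_XsubC.
suff [d d0 Hd] : exists2 d : R, 0 < d & forall a, a \in s -> P a d.
  by exists d => // a; rewrite root_prod_XsubC; exact: Hd.
elim: s H => [|a s IH] H; first by exists 1.
have [|d d0 Hd] := IH; first by move=> b sb; apply: H; rewrite inE sb orbT.
have [e e0 He] := H a (mem_head _ _).
exists (Num.min e d); first by rewrite lt_min e0.
move=> b; rewrite inE => /predU1P[->|sb].
  by apply: Pmon He; rewrite ge_min lexx.
by apply: Pmon (Hd b sb); rewrite ge_min lexx orbT.
Qed.

(** A supremum argument on (0, 1]. [M] may have eigenvalues on the axis, so the first hypothesis
    only asks for Re z <= 0 at small positive t; the second one makes this strict. *)
Lemma hurwitz_homotopy n (M E : 'M[R[i]]_n) :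
  (forall p, root (char_poly M) p -> exists2 d : R, 0 < d &
     forall t z, 0 < t < d -> root (char_poly (M + t%:C *: E)) z ->
       cmod (z - p) < d -> complex.Re z <= 0) ->
  (forall t z, 0 < t <= 1 -> root (char_poly (M + t%:C *: E)) z ->
     complex.Re z <> 0) ->
  forall z, root (char_poly (M + E)) z -> complex.Re z < 0.
Proof.
move=> H0 axis.
pose good t := forall z, root (char_poly (M + t%:C *: E)) z -> complex.Re z < 0.
have goodW t : 0 < t <= 1 ->
    (forall z, root (char_poly (M + t%:C *: E)) z -> complex.Re z <= 0) -> good t.
  move=> t01 H z rz; rewrite lt_neqAle H// andbT.
  by apply/eqP; exact: (axis t).
have E1 : 0 < mxn E + 1 by rewrite ltr_wpDl// mxn_ge0.
pose S : set R := [set t | 0 < t <= 1 /\ forall s, 0 < s <= t -> good s].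
have [t St] : exists t, S t.
  have [||d d0 Hd] := root_uniform (M := M)
     (P := fun p d => forall t z, 0 < t < d -> root (char_poly (M + t%:C *: E)) z ->
       cmod (z - p) < d -> complex.Re z <= 0).
  - move=> a d d' dd H u z /andP[u0 ud] rz za; apply: (H u) => //.
      by rewrite u0 (lt_le_trans ud).
    exact: lt_le_trans za dd.
  - exact: H0.
  have [e e0 He] := eigenvalue_perturb M d0.
  (* The three bounds give t < 1, t < d, and norm of s E below [e] for s <= t. *)
  pose t := Num.min (2^-1) (Num.min (d / 2) (e / (mxn E + 1))).
  have t0 : 0 < t by rewrite !lt_min invr_gt0 ltr0n !divr_gt0.
  have t1 : t < 1 by rewrite gt_min; apply/orP; left; lra.
  have td : t < d by rewrite !gt_min; apply/orP; right; apply/orP; left; lra.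
  have te : t <= e / (mxn E + 1) by rewrite !ge_min lexx !orbT.
  exists t; split; first by rewrite t0 ltW.
  move=> s /andP[s0 st]; apply: goodW.
    by rewrite s0 (le_trans st)// ltW.
  move=> z rz; have [|a ra za] := He (s%:C *: E) _ z rz.
    rewrite mxnZ cmod_real gtr0_norm//.
    rewrite (@lt_le_trans _ _ (s * (mxn E + 1)))// ?ltr_pM2l ?ltrDl//.
    by rewrite -ler_pdivlMr// (le_trans st).
  by apply: (Hd a ra s) => //; rewrite s0 (le_lt_trans st).
have supS : has_sup S by split; [exists t | exists 1 => x [/andP[]]].
pose t0 := sup S.
have tt0 : t <= t0 by apply: sup_upper_bound.
have t00 : 0 < t0 by case: St => /andP[t_gt0 _] _; exact: lt_le_trans tt0.
have t01 : t0 <= 1 by apply: ge_sup; [exists t | move=> x [/andP[]]].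
have below s : 0 < s < t0 -> good s.
  move=> /andP[s0 st]; have [|u [Su Hu]] := @sup_adherent _ S (t0 - s) _ supS.
    by rewrite subr_gt0.
  by rewrite subKr => su; apply: Hu; rewrite s0 ltW.
(* An eigenvalue z at t0 with Re z > 0 is impossible: for s just below t0 the spectrum is in the
   left half plane, so |det (z - A(s))| >= (Re z)^n, although this determinant tends to 0. *)
have good0 : good t0.
  move=> z rz; have [//|z0|z0] := ltgtP (complex.Re z) 0; last first.
    by case: (axis t0 z) => //; rewrite t00.
  exfalso.
  have zn : 0 < complex.Re z ^+ n by rewrite exprn_gt0.
  have Dz : \det ((z%:M - M) + t0%:C *: - E) = 0.
    by rewrite scalerN -addrA -opprD -char_poly_eval; exact/eqP.
  have [d d0 Hd] := det_pencil_cont zn Dz.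
  pose s := Num.max (t0 / 2) (t0 - d / 2).
  have s0 : 0 < s by rewrite lt_max divr_gt0.
  have st : s < t0 by rewrite gt_max; apply/andP; split; lra.
  have sd : t0 - d / 2 <= s by rewrite le_max lexx orbT.
  have /Hd : `|s - t0| < d by rewrite ltr_norml; apply/andP; split; lra.
  rewrite scalerN -addrA -opprD ltNge => /negP; apply.
  apply: char_poly_lower; first exact: ltW.
  move=> a ra; have a0 := below s _ a ra.
  have {}a0 : complex.Re a < 0 by apply: a0; rewrite s0.
  rewrite (le_trans _ (Re_le_cmod _))// (le_trans _ (ler_norm _))//.
  by rewrite raddfB /= lerBrDr gerDl ltW.
have [t1|t1] := ltP t0 1; last first.
  have {t1} t1 : t0 = 1 by apply/le_anti; rewrite t01 t1.
  by move: good0; rewrite t1 /good scale1r.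
exfalso.
(* At t0 < 1 the spectrum keeps a distance [e] from the axis, so stability extends beyond t0. *)
have [||e e0 He] := root_uniform (M := M + t0%:C *: E)
     (P := fun p d => complex.Re p + d <= 0).
- by move=> a d d' dd; apply: le_trans; rewrite lerD2l.
- by move=> a ra; exists (- complex.Re a); rewrite ?subrr// oppr_gt0; exact: good0.
have [d d0 Hd] := eigenvalue_perturb (M + t0%:C *: E) e0.
(* For s <= u the matrix (s - t0) E has norm below [d]. *)
pose u := Num.min 1 (t0 + d / (mxn E + 1) / 2).
have d1 : 0 < d / (mxn E + 1) by rewrite divr_gt0.
have tu : t0 < u by rewrite lt_min t1; lra.
suff /(sup_upper_bound supS) : S u by rewrite leNgt tu.
split; first by rewrite (lt_trans t00)//= ge_min lexx.
move=> s /andP[s0 su]; have [st|ts|->//] := ltgtP s t0.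
  by apply: below; rewrite s0.
move=> z.
have -> : M + s%:C *: E = M + t0%:C *: E + (s - t0)%:C *: E.
  by rewrite -addrA -scalerDl -rmorphD /= [t0 + _]addrC subrK.
move=> rz; have [|a ra za] := Hd _ _ z rz.
  rewrite mxnZ cmod_real gtr0_norm ?subr_gt0//.
  rewrite (@le_lt_trans _ _ ((s - t0) * (mxn E + 1)))// ?ler_wpM2l ?lerDl ?subr_ge0 ?ltW//.
  rewrite -ltr_pdivlMr// (@le_lt_trans _ _ (u - t0)) ?lerD2r//.
  have : u <= t0 + d / (mxn E + 1) / 2 by rewrite ge_min lexx orbT.
  lra.
have := He a ra; have := Re_le_cmod (z - a); have := ler_norm (complex.Re (z - a)).
rewrite raddfB /=; lra.
Qed.

End Homotopy.

(** * Realizations of rational transfer functions *)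

Section RationalFunctions.
Variable R : rcfType.
Local Notation tofrac := (@FracField.tofrac {poly R}).

Lemma rnum_rden_spec (f : ratfun R) :
  [/\ f * tofrac (rden f) = tofrac (rnum f), rden f != 0
    & coprimep (rnum f) (rden f)].
Proof.
rewrite /rnum /rden; set x := generic_quotient.repr f.
have dx0 : \d_x != 0 := denom_ratioP x.
have g0 : gcdp \n_x \d_x != 0 by rewrite gcdp_eq0 negb_and dx0 orbT.
have En := divpK (dvdp_gcdl \n_x \d_x); have Ed := divpK (dvdp_gcdr \n_x \d_x).
have fx : f * tofrac \d_x = tofrac \n_x.
  rewrite -[f]generic_quotient.reprK -/x; unlock FracField.tofrac.
  rewrite -[LHS]FracField.pi_mul; apply/generic_quotient.eqmodP.
  rewrite /= FracField.equivfE /FracField.mulf !numden_Ratio ?oner_eq0 ?mulr1//.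
  by rewrite mulrC.
split.
- apply: (mulIf (x := tofrac (gcdp \n_x \d_x))); first by rewrite tofrac_eq0.
  by rewrite -mulrA -!rmorphM /= En Ed.
- by apply: contraNneq dx0 => d0; rewrite -Ed d0 mul0r.
- by rewrite coprimep_div_gcd// dx0 orbT.
Qed.

Lemma rnum_rden_eq (f : ratfun R) (p q : {poly R}) :
  f * tofrac q = tofrac p -> rnum f * q = p * rden f.
Proof.
have [Ef d0 _] := rnum_rden_spec f => fq.
apply/eqP; rewrite -tofrac_eq !rmorphM /= -Ef -fq.
by apply/eqP; ring.
Qed.

(** Any fraction whose denominator does not vanish at s computes the value: a zero of the reduced
    denominator would also be one of the reduced numerator, against coprimality. *)
Lemma reval_eq (f : ratfun R) (p q : {poly R}) (s : R[i]) :
  f * tofrac q = tofrac p -> (polyRC q).[s] != 0 ->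
  pole_order f s = 0%N /\ reval f s = (polyRC p).[s] / (polyRC q).[s].
Proof.
move=> /rnum_rden_eq /(congr1 (@polyRC R)); rewrite /polyRC !rmorphM /=.
move=> /(congr1 (horner_eval s)); rewrite /horner_eval !hornerM => E q0.
have d0 : (polyRC (rden f)).[s] != 0.
  apply/negP => /eqP d0; move: E; rewrite d0 mulr0 => /eqP.
  rewrite mulf_eq0 (negPf q0) orbF => n0.
  have [_ _ cop] := rnum_rden_spec f.
  move: cop; rewrite -(coprimep_map (real_complex R)) => /coprimep_root /(_ n0).
  by rewrite d0 eqxx.
split; first by rewrite /pole_order mupNroot.
by rewrite /reval; apply/eqP; rewrite eqr_div// E.
Qed.

(** Stated by divisibility rather than by multiplicities because divisibility is linear in [p] and
    makes no exception for [p = 0]. *)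
Lemma pole_order_dvd (f : ratfun R) (p q : {poly R}) (s : R[i]) (r k : nat) :
  f * tofrac q = tofrac p -> (pole_order f s <= r)%N ->
  ('X - s%:P) ^+ k %| polyRC q -> ('X - s%:P) ^+ k %| ('X - s%:P) ^+ r * polyRC p.
Proof.
move=> /rnum_rden_eq /(congr1 (@polyRC R)); rewrite /polyRC !rmorphM /= => E.
have [_ d0 _] := rnum_rden_spec f.
rewrite /pole_order /polyRC => ord kq.
have dC0 : map_poly (real_complex R) (rden f) != 0 by rewrite map_poly_eq0.
have [l [g /implyP g0 Ed]] := multiplicity_XsubC (map_poly (real_complex R) (rden f)) s.
have {}g0 := g0 dC0.
have gn0 : g != 0 by apply: contraNneq g0 => ->; rewrite root0.
have lr : (l <= r)%N.
  by move: ord; rewrite Ed mupMr// mup_XsubCX eqxx.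
have : ('X - s%:P) ^+ k %| map_poly (real_complex R) p * (g * ('X - s%:P) ^+ l).
  by rewrite -Ed -E dvdp_mull.
rewrite mulrCA Gauss_dvdpr; last by rewrite coprimep_expl// coprimep_sym coprimep_XsubC.
move=> H; rewrite -(subnK lr) exprD -mulrA [_ ^+ l * _]mulrC.
exact: dvdp_mull.
Qed.

End RationalFunctions.

Lemma det_scale_invmx (F : fieldType) n (X : 'M[F]_n) :
  X \in unitmx -> \det X *: invmx X = \adj X.
Proof.
by move=> U; rewrite /invmx U scalerA divrr ?scale1r// -unitmxE.
Qed.

(** * State-space realizations and minimality *)

Section Realizations.
Variables (R : rcfType) (m : nat).
Local Notation C := R[i].
Local Notation RC := (real_complex R).
Local Notation tofrac := (@FracField.tofrac {poly R}).
Implicit Types G : tfmx R m.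

Lemma charmx_frac n (A : 'M[R]_n) :
  map_mx tofrac (char_poly_mx A) = (tofrac 'X)%:M - map_mx (@ratC R) A.
Proof.
rewrite /char_poly_mx map_mxB map_scalar_mx /=; congr (_ - _).
by apply/matrixP => i j; rewrite !mxE.
Qed.

Lemma charmx_frac_unit n (A : 'M[R]_n) : map_mx tofrac (char_poly_mx A) \in unitmx.
Proof.
by rewrite unitmxE det_map_mx unitfE tofrac_eq0 monic_neq0// char_poly_monic.
Qed.

Lemma map_ratCM a b c (M : 'M[R]_(a, b)) (N : 'M[R]_(b, c)) :
  map_mx (@ratC R) (M *m N) = map_mx (@ratC R) M *m map_mx (@ratC R) N.
Proof. exact: (map_mxM (tofrac \o polyC)). Qed.

(** Cramer's rule: the numerator over the common denominator [char_poly (ssA S)], with possible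
    common factors left in. *)
Definition transfer_num n (S : state_space R n m) : 'M[{poly R}]_m :=
  map_mx polyC (ssC S) *m \adj (char_poly_mx (ssA S)) *m map_mx polyC (ssB S)
  + char_poly (ssA S) *: map_mx polyC (ssD S).

Lemma transferE n (S : state_space R n m) i j :
  transfer S i j * tofrac (char_poly (ssA S)) = tofrac (transfer_num S i j).
Proof.
have U := charmx_frac_unit (ssA S).
have mapR p q (M : 'M[R]_(p, q)) : map_mx (@ratC R) M = map_mx tofrac (map_mx polyC M).
  by rewrite -map_mx_comp.
have E : tofrac (char_poly (ssA S)) *: transfer S = map_mx tofrac (transfer_num S).
  rewrite /transfer /transfer_num !mapR [RHS]map_mxD /= !map_mxM /= map_mxZ /= scalerDr; congr (_ + _).
  rewrite scalemxAl scalemxAr; congr (_ *m _ *m _).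
  by move: (det_scale_invmx U); rewrite det_map_mx -map_mx_adj.
by move/matrixP: E => /(_ i j); rewrite !mxE mulrC.
Qed.

Definition cA n (S : state_space R n m) : 'M[C]_n := map_mx RC (ssA S).
Definition cB n (S : state_space R n m) : 'M[C]_(n, m) := map_mx RC (ssB S).
Definition cC n (S : state_space R n m) : 'M[C]_(m, n) := map_mx RC (ssC S).
Definition cD n (S : state_space R n m) : 'M[C]_m := map_mx RC (ssD S).

Lemma charpoly_cA n (S : state_space R n m) :
  char_poly (cA S) = polyRC (char_poly (ssA S)).
Proof. by rewrite /cA -map_char_poly. Qed.

Lemma transfer_num_cplx n (S : state_space R n m) :
  map_mx (@polyRC R) (transfer_num S) =
  map_mx polyC (cC S) *m \adj (char_poly_mx (cA S)) *m map_mx polyC (cB S)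
  + char_poly (cA S) *: map_mx polyC (cD S).
Proof.
have mapP p q (M : 'M[R]_(p, q)) :
    map_mx (@polyRC R) (map_mx polyC M) = map_mx polyC (map_mx RC M).
  by rewrite -!map_mx_comp; apply: eq_map_mx => a /=; rewrite /polyRC map_polyC.
rewrite /transfer_num [LHS]map_mxD /= !map_mxM /= map_mxZ -!/(@polyRC R) !mapP charpoly_cA.
by rewrite map_mx_adj /cA -map_char_poly_mx.
Qed.

Lemma tfeval_transfer G n (S : state_space R n m) (s : C) :
  transfer S = G -> ~~ root (char_poly (cA S)) s ->
  ~ tfpole G s /\
  tfeval G s = cC S *m invmx (s%:M - cA S) *m cB S + cD S.
Proof.
move=> <- s0; have H i j := reval_eq (transferE S i j).
have {}H i j : pole_order (transfer S i j) s = 0%N /\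
    reval (transfer S i j) s =
      (polyRC (transfer_num S i j)).[s] / (polyRC (char_poly (ssA S))).[s].
  by apply: H; rewrite -charpoly_cA.
split; first by move=> [i [j]]; rewrite (H i j).1.
have U : s%:M - cA S \in unitmx by rewrite unitmxE unitfE -char_poly_eval.
have -> : tfeval (transfer S) s =
    (char_poly (cA S)).[s]^-1 *: map_mx (horner_eval s) (map_mx (@polyRC R) (transfer_num S)).
  apply/matrixP => i j; rewrite [LHS]mxE (H i j).2 charpoly_cA [RHS]mxE mulrC.
  by rewrite [in RHS]mxE [in RHS]mxE.
have mapE p q (M : 'M[C]_(p, q)) : map_mx (horner_eval s) (map_mx polyC M) = M.
  by apply/matrixP => i j; rewrite !mxE /= /horner_eval hornerC.
rewrite transfer_num_cplx [in LHS]map_mxD /= !map_mxM /= map_mxZ !mapE scalerDr map_mx_adj.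
rewrite char_poly_mx_eval scalerA mulVf// scale1r; congr (_ + _).
rewrite scalemxAl scalemxAr; congr (_ *m _ *m _).
by rewrite -(det_scale_invmx U) char_poly_eval scalerA mulVf ?scale1r// -char_poly_eval.
Qed.

(** The dual system, which exchanges observability and controllability. *)
Definition trss n (S : state_space R n m) : state_space R n m :=
  StateSpace (ssA S)^T (ssC S)^T (ssB S)^T (ssD S)^T.

Lemma transfer_tr n (S : state_space R n m) : transfer (trss S) = (transfer S)^T.
Proof.
have EX : map_mx tofrac (char_poly_mx (ssA S)^T) = (map_mx tofrac (char_poly_mx (ssA S)))^T.
  by rewrite !charmx_frac raddfB /= tr_scalar_mx map_trmx.
rewrite /transfer /trss /= EX -trmx_inv -!map_trmx -!trmx_mul -mulmxA -linearD.
by rewrite mulmxA.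
Qed.

Lemma minimal_tr G n (S : state_space R n m) :
  minimal_realization G S -> minimal_realization G^T (trss S).
Proof.
move=> [<- H]; split=> [|n' S' ES']; first exact: transfer_tr.
by apply: (H n' (trss S')); rewrite transfer_tr ES' trmxK.
Qed.

(** [U] intertwines sI - A with sI - A', hence also their inverses. *)
Lemma transfer_reduce n r (S : state_space R n m) (U : 'M[R]_(r, n))
    (A' : 'M[R]_r) (C' : 'M[R]_(m, r)) :
  U *m ssA S = A' *m U -> ssC S = C' *m U ->
  transfer (StateSpace A' (U *m ssB S) C' (ssD S)) = transfer S.
Proof.
move=> UA CU; rewrite /transfer /= CU !map_ratCM -!mulmxA; congr (_ *m _ + _).
rewrite !mulmxA; congr (_ *m _).
have UX : map_mx (@ratC R) U *m map_mx tofrac (char_poly_mx (ssA S))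
    = map_mx tofrac (char_poly_mx A') *m map_mx (@ratC R) U.
  by rewrite !charmx_frac mulmxBr mulmxBl scalar_mxC -!map_ratCM UA.
rewrite -[LHS](mulmxK (charmx_frac_unit (ssA S))) -[_ *m _ *m map_mx tofrac _]mulmxA.
by rewrite UX mulKmx ?charmx_frac_unit.
Qed.

(** Observability as an induction principle. A free family in [P] of maximal size r spans [P]; its
    span is A-invariant and contains the rows of C, so [transfer_reduce] gives a realization of size
    r, and minimality forces r = n. *)
Lemma observable_ind G n (S : state_space R n m) (P : 'rV[R]_n -> Prop) :
  minimal_realization G S ->
  P 0 -> (forall a u v, P u -> P v -> P (a *: u + v)) ->
  (forall v, P v -> P (v *m ssA S)) -> (forall i, P (row i (ssC S))) ->
  forall v, P v.
Proof.
move=> [ES Smin] P0 PD PA PC.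
pose Q r := `[< exists2 U : 'M[R]_(r, n), row_free U & forall i, P (row i U) >].
have Q0 : exists r, Q r.
  exists 0%N; apply/asboolP; exists 0; last by case.
  by rewrite /row_free mxrank0.
have Qn r : Q r -> (r <= n)%N.
  by move=> /asboolP[U /eqP rU _]; rewrite -{1}rU; exact: rank_leq_col.
have [r /asboolP[U Ufree PU] rmax] := ex_maxnP Q0 Qn.
have Pspan v : (v <= U)%MS -> P v.
  move=> /submxP[w ->]; rewrite mulmx_sum_row.
  by elim/big_ind: _ => // [u v' Pu Pv|i _]; [rewrite -[u]scale1r | rewrite -[_ *: _]addr0]; exact: PD.
(* Otherwise appending [v] to [U] would give a larger free family. *)
have spanP v : P v -> (v <= U)%MS.
  move=> Pv; apply: contraT => vU.
  suff : Q (r + 1)%N by move/rmax; rewrite addn1 ltnn.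
  apply/asboolP; exists (col_mx U v).
    apply: inj_row_free => w; rewrite -[w]hsubmxK mul_row_col => w0.
    have [b0|b0] := eqVneq (rsubmx w) 0.
      move: w0; rewrite b0 mul0mx addr0 => w0.
      by rewrite [lsubmx w](row_free_inj Ufree (_ : _ = 0 *m U)) ?mul0mx// row_mx0.
    case/negP: vU; move: w0 b0; rewrite [rsubmx w]mx11_scalar => w0 b0.
    set b := rsubmx w 0 0 in w0 b0.
    have {}b0 : b != 0 by apply: contraNneq b0 => ->; rewrite raddf0.
    apply/submxP; exists (- b^-1 *: lsubmx w).
    rewrite -scalemxAl; move/eqP: w0; rewrite addr_eq0 => /eqP ->.
    by rewrite mul_scalar_mx scalerN scaleNr opprK scalerA mulVf// scale1r.
  move=> i; case: (split_ordP i) => j ->.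
    by rewrite rowKu.
  by rewrite rowKd [j]ord1 row_id.
have /submxP[C' EC] : (ssC S <= U)%MS by apply/row_subP => i; exact: spanP.
have /submxP[A' EA] : (U *m ssA S <= U)%MS.
  by apply/row_subP => i; rewrite row_mul; apply/spanP/PA.
have nr := Smin _ _ (etrans (transfer_reduce EA EC) ES).
move=> v; apply: Pspan; apply: submx_full.
by rewrite /row_full (eqP Ufree) eqn_leq nr andbT -(eqP Ufree) rank_leq_col.
Qed.

Lemma controllable_ind G n (S : state_space R n m) (P : 'cV[R]_n -> Prop) :
  minimal_realization G S ->
  P 0 -> (forall a u v, P u -> P v -> P (a *: u + v)) ->
  (forall v, P v -> P (ssA S *m v)) -> (forall i, P (col i (ssB S))) ->
  forall v, P v.
Proof.
move=> /minimal_tr Smin P0 PD PA PB v; rewrite -[v]trmxK.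
apply: (observable_ind (P := fun u => P u^T) Smin) => [|a u w Pu Pw|u Pu|i].
- by rewrite trmx0.
- by rewrite linearP; exact: PD.
- by rewrite trmx_mul trmxK; exact: PA.
- by rewrite tr_row trmxK.
Qed.

End Realizations.

(** * Resolvents at the poles of the transfer function *)

Section PoleStructure.
Variables (R : rcfType) (m : nat).
Local Notation C := R[i].
Local Notation RC := (real_complex R).
Implicit Types G : tfmx R m.

Lemma polymx_cancel (p : {poly C}) a b (M N : 'M[{poly C}]_(a, b)) :
  p != 0 -> p *: M = p *: N -> M = N.
Proof.
move=> p0 E; apply/matrixP => i j; apply: (mulfI p0).
by move/matrixP: E => /(_ i j); rewrite !mxE.
Qed.

Lemma entryBZ (F : comNzRingType) p q (a b : F) (M N : 'M[F]_(p, q)) i j :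
  (a *: M - b *: N) i j = a * M i j - b * N i j.
Proof. by rewrite !mxE. Qed.

Lemma entryDZ (F : comNzRingType) p q (b : F) (M N : 'M[F]_(p, q)) i j :
  (M + b *: N) i j = M i j + b * N i j.
Proof. by rewrite !mxE. Qed.

(** Minimality carries the pole order of the entries of G over to the whole resolvent. With e = X -
    l and e^k the power of e in the characteristic polynomial, the claim is that e^k divides e^r adj
    (X - A). The pole order gives this for C adj B; the two induction principles then replace C and
    B by arbitrary vectors. *)
Lemma resolvent_pole G n (S : state_space R n m) (l : C) (r : nat) :
  minimal_realization G S ->
  (forall i j, (pole_order (G i j) l <= r)%N) ->
  exists (M : 'M[{poly C}]_n) (c : {poly C}), c.[l] != 0 /\
    M *m char_poly_mx (cA S) = (('X - l%:P) ^+ r * c)%:M.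
Proof.
move=> Smin ord; have ES := Smin.1.
set XA := char_poly_mx (cA S); set e := 'X - l%:P.
have chi0 : char_poly (cA S) != 0 by rewrite monic_neq0// char_poly_monic.
have [k [c /implyP/(_ chi0) c0 Ec]] := multiplicity_XsubC (char_poly (cA S)) l.
have kchi : e ^+ k %| char_poly (cA S) by rewrite Ec dvdp_mull.
pose F p q (M : 'M[R]_(p, q)) := map_mx polyC (map_mx RC M).
have FD p q a (M N : 'M_(p, q)) : F p q (a *: M + N) = (RC a)%:P *: F p q M + F p q N.
  by apply/matrixP => i j; rewrite !mxE !rmorphD !rmorphM.
have F0 p q : F p q 0 = 0 by apply/matrixP => i j; rewrite !mxE !rmorph0.
have FM p q u (M : 'M_(p, q)) (N : 'M_(q, u)) : F p u (M *m N) = F p q M *m F q u N.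
  by rewrite /F !map_mxM.
have FA : F n n (ssA S) = 'X%:M - XA by rewrite /XA /char_poly_mx opprB addrC subrK.
have adjX : \adj XA *m XA = (char_poly (cA S))%:M by rewrite mul_adj_mx.
have Xadj : XA *m \adj XA = (char_poly (cA S))%:M by rewrite mul_mx_adj.
(* Since e^k divides the last term, the divisibility condition passes from v to v A. *)
have EA1 (v : 'rV_n) : F _ _ (v *m ssA S) *m \adj XA
    = 'X *: (F _ _ v *m \adj XA) - char_poly (cA S) *: F _ _ v.
  by rewrite FM FA mulmxBr mulmxBl -!mulmxA Xadj scalar_mxC !mulmxA scalar_mxC -!mulmxA !mul_scalar_mx.
have EA2 (w : 'cV_n) : \adj XA *m F _ _ (ssA S *m w)
    = 'X *: (\adj XA *m F _ _ w) - char_poly (cA S) *: F _ _ w.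
  rewrite FM FA mulmxA mulmxBr mulmxBl adjX scalar_mxC -!mulmxA.
  by rewrite !mul_scalar_mx.
have step1 : forall (v : 'rV_n) j, e ^+ k %| e ^+ r * (F _ _ v *m \adj XA *m F _ _ (ssB S)) 0 j.
  apply: (observable_ind Smin) => [j|a u v Hu Hv j|v Hv j|i j].
  - by rewrite F0 !mul0mx mxE mulr0 dvdp0.
  - rewrite FD !mulmxDl -!scalemxAl mxE [X in X + _]mxE mulrDr mulrCA dvdp_add//.
    by rewrite dvdp_mull.
  - rewrite EA1 mulmxBl -!scalemxAl entryBZ mulrBr.
    by rewrite dvdp_sub// mulrCA; [rewrite dvdp_mull | rewrite dvdp_mulr].
  - have -> : F _ _ (row i (ssC S)) *m \adj XA *m F _ _ (ssB S)
      = row i (F _ _ (ssC S) *m \adj XA *m F _ _ (ssB S)).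
      by rewrite !row_mul /F !map_row.
    rewrite mxE; have := pole_order_dvd (transferE S i j) _ _ (s := l) (r := r) (k := k).
    rewrite ES -charpoly_cA => /(_ (ord i j) kchi).
    have /matrixP/(_ i j) := transfer_num_cplx S; rewrite mxE => ->.
    rewrite entryDZ mulrDr dvdp_addl//.
    by rewrite mulrCA dvdp_mulr.
have step2 (v : 'rV_n) : forall w : 'cV_n, e ^+ k %| e ^+ r * (F _ _ v *m \adj XA *m F _ _ w) 0 0.
  apply: (controllable_ind Smin) => [|a u w Hu Hw|w Hw|j].
  - by rewrite F0 mulmx0 mxE mulr0 dvdp0.
  - rewrite FD mulmxDr -scalemxAr mxE [X in X + _]mxE mulrDr mulrCA dvdp_add//.
    by rewrite dvdp_mull.
  - rewrite -mulmxA EA2 mulmxBr -!scalemxAr entryBZ mulrBr.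
    rewrite dvdp_sub// mulrCA; first by rewrite dvdp_mull// mulmxA.
    by rewrite dvdp_mulr.
  - have -> : F _ _ v *m \adj XA *m F _ _ (col j (ssB S))
      = col j (F _ _ v *m \adj XA *m F _ _ (ssB S)).
      by rewrite /F !map_col !colE !mulmxA.
    by rewrite mxE step1.
have adj_dvd i j : e ^+ k %| e ^+ r * \adj XA i j.
  have := step2 (delta_mx 0 i) (delta_mx j 0).
  have Fd p q (a : 'I_p) (b : 'I_q) : F p q (delta_mx a b) = delta_mx a b.
    by apply/matrixP => x y; rewrite !mxE; case: (_ && _); rewrite ?rmorph1 ?rmorph0.
  by rewrite !Fd -rowE -colE !mxE.
have e0 : e ^+ k != 0 by rewrite expf_neq0// polyXsubC_eq0.
exists (\matrix_(i, j) (e ^+ r * \adj XA i j %/ e ^+ k)), c.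
set M := \matrix_(i, j) _.
have EM : e ^+ k *: M = e ^+ r *: \adj XA.
  by apply/matrixP => i j; rewrite [LHS]mxE [X in _ * X]mxE [RHS]mxE mulrC divpK.
split; first exact: c0.
apply: (polymx_cancel e0).
rewrite scalemxAl EM -scalemxAl adjX Ec !scale_scalar_mx; congr (_%:M); ring.
Qed.

(** The case r = 0: M(l) (l - A) = c(l) with c(l) nonzero, so l - A is injective. *)
Lemma no_pole_no_eigenvalue G n (S : state_space R n m) (l : C) :
  minimal_realization G S -> ~ tfpole G l -> ~~ root (char_poly (cA S)) l.
Proof.
move=> Smin np; have [|M [c [c0 MX]]] := resolvent_pole (l := l) (r := 0) Smin.
  move=> i j; rewrite leqNgt; apply/negP => ij; apply: np; by exists i, j.
move: MX; rewrite mul1r => /(congr1 (map_mx (horner_eval l))).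
rewrite map_mxM map_scalar_mx char_poly_mx_eval /= /horner_eval => MX.
apply/negP => /char_poly_root_col[x x0 Ax].
have : c.[l] *: x = 0.
  by rewrite -mul_scalar_mx -MX -mulmxA mulmxBl mul_scalar_mx Ax subrr mulmx0.
by move/eqP; rewrite scalemx_eq0 (negPf c0) (negPf x0).
Qed.

(* P is the residue of the resolvent at l, and T is the constant term of its
   Laurent expansion up to a multiple of P. *)
Lemma simple_pole_projector G n (S : state_space R n m) (l : C) :
  minimal_realization G S ->
  (forall i j, (pole_order (G i j) l <= 1)%N) ->
  exists P T : 'M[C]_n,
    P *m (l%:M - cA S) = 0 /\ T *m (l%:M - cA S) = 1%:M - P.
Proof.
move=> Smin ord; have [M [c [c0 MX]]] := resolvent_pole Smin ord.
pose ev := @horner_eval C l.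
have M0 : map_mx ev M *m (l%:M - cA S) = 0.
  rewrite -char_poly_mx_eval -map_mxM MX map_scalar_mx /= /ev /horner_eval.
  by rewrite hornerM hornerXsubC subrr mul0r raddf0.
(* The derivative of M (X - A) = (X - l) c; at l it reads M'(l) (l - A) + M(l) = c(l). Hence P =
   M(l) / c(l) and T = M'(l) / c(l). *)
have dM : map_mx deriv M *m char_poly_mx (cA S) + M = ('X - l%:P)%:M *m c^`()%:M + c%:M.
  have : map_mx deriv (M *m char_poly_mx (cA S)) = map_mx deriv (('X - l%:P) * c)%:M.
    by rewrite MX.
  rewrite [X in _ = X -> _](_ : _ = ('X - l%:P)%:M *m c^`()%:M + c%:M); last first.
    rewrite -scalar_mxM -raddfD; apply/matrixP => i j; rewrite !mxE derivMn derivM.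
    by rewrite derivXsubC mul1r addrC.
  move=> <-; apply/matrixP => i j; rewrite !mxE raddf_sum /=.
  have -> : M i j = \sum_k M i k * (k == j)%:R.
    rewrite (bigD1 j)//= eqxx mulr1 big1 ?addr0// => k /negPf ->.
    by rewrite mulr0.
  rewrite -big_split; apply: eq_bigr => k _; rewrite !mxE /= derivM; congr (_ + _ * _).
  by rewrite derivD derivN derivC subr0 derivMn derivX.
have {}dM : map_mx ev (map_mx deriv M) *m (l%:M - cA S) + map_mx ev M = c.[l]%:M.
  move/(congr1 (map_mx ev)): dM.
  rewrite map_mxD map_mxM char_poly_mx_eval map_mxD map_mxM !map_scalar_mx /=.
  by rewrite /ev {3 4 5}/horner_eval hornerXsubC subrr raddf0 mul0mx add0r.
exists (c.[l]^-1 *: map_mx ev M), (c.[l]^-1 *: map_mx ev (map_mx deriv M)).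
split; first by rewrite -scalemxAl M0 scaler0.
rewrite -scalemxAl; apply/eqP; rewrite -subr_eq0 opprB addrA -scalerDr dM.
by rewrite scale_scalar_mx mulVf// subrr.
Qed.

End PoleStructure.

(** * Limits at infinity and at simple poles *)

Lemma lim_mxE (R : realType) (m : nat) (T : Type) (F : set_system T)
    {FF : ProperFilter F} (f : T -> 'M[R[i]]_m) (L : 'M[R[i]]_m) :
  (forall e : R, 0 < e -> F [set x | mxn (f x - L) < e]) ->
  lim (f x @[x --> F]) = L.
Proof.
case: m f L => [|m] f L H; first by apply/matrixP => -[].
apply: cvg_lim; first exact: norm_hausdorff.
apply/cvg_ballP => e e0.
have Ee : e = (complex.Re e)%:C by rewrite RRe_real// gtr0_real.
have er0 : 0 < complex.Re e by rewrite -ltcR -Ee.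
apply: filterS (H _ er0) => x /= Hx; split=> // i j.
rewrite /ball/= /ball_ distrC cmodE Ee ltcR.
by apply: le_lt_trans Hx; have := mxn_entry (f x - L) i j; rewrite !mxE.
Qed.

Section Resolvent.
Variable R : realType.
Local Notation C := R[i].

Lemma resolvent_infty n k (A : 'M[C]_n) (X B : 'M[C]_(n, k)) (s : C) :
  (s%:M - A) *m X = B -> (cmod s - mxn A) * mxn X <= mxn B.
Proof.
rewrite mulmxBl mul_scalar_mx => E.
rewrite mulrBl -mxnZ -[s *: X](subrK (A *m X)) E lerBlDr.
by rewrite (le_trans (mxnD _ _))// lerD2l mxnM.
Qed.

(** Multiply (p - A) X + (s - p) X = W on the left by P and by T. The case s = p is included, and P
    = 0 with T an inverse covers regular points. *)
Lemma resolvent_near_pole n k (A P T : 'M[C]_n) (X W : 'M[C]_(n, k)) (p s : C) :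
  P *m (p%:M - A) = 0 -> T *m (p%:M - A) = 1%:M - P ->
  (s%:M - A) *m X = W ->
  (s - p) *: (P *m X) = P *m W /\ X = P *m X + T *m W - (s - p) *: (T *m X).
Proof.
move=> PA TA E.
have {}E : (p%:M - A) *m X + (s - p) *: X = W.
  rewrite -E -mul_scalar_mx -mulmxDl; congr (_ *m _).
  by rewrite raddfB /= addrC addrA subrK.
rewrite -E !mulmxDr !mulmxA PA TA mulmxBl mul1mx mul0mx add0r -!scalemxAr.
by split => //; rewrite addrA addrK addrC subrK.
Qed.

(** With h = s - p, the condition |h| |T| <= 1/2 absorbs the term in h X on the right: |h X| <= 2
    (|P| + |T|) |W|. Then Y = T W - T (h X) has a bound independent of s. *)
Lemma resolvent_near_pole_bound n k (A P T : 'M[C]_n) (X W : 'M[C]_(n, k)) (p s : C) :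
  P *m (p%:M - A) = 0 -> T *m (p%:M - A) = 1%:M - P ->
  (s%:M - A) *m X = W -> cmod (s - p) <= 1 -> cmod (s - p) * mxn T <= 2^-1 ->
  exists Y : 'M[C]_(n, k), (s - p) *: X = P *m W + (s - p) *: Y /\
    mxn Y <= (mxn T + 2 * mxn T * (mxn P + mxn T)) * mxn W.
Proof.
move=> PA TA E h1 hT; have [PX XE] := resolvent_near_pole PA TA E.
set h := s - p in PX XE h1 hT *.
exists (T *m W - T *m (h *: X)).
have hX : h *: X = P *m W + h *: (T *m W - T *m (h *: X)).
  by rewrite {1}XE 2!scalerDr PX -addrA -scalerDr -scalemxAr.
split => //.
have B1 : mxn (h *: X) <= 2 * (mxn P + mxn T) * mxn W.
  suff : mxn (h *: X) <= (mxn P + mxn T) * mxn W + 2^-1 * mxn (h *: X) by lra.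
  rewrite {1}hX (le_trans (mxnD _ _))// mulrDl -addrA lerD ?mxnM//.
  rewrite mxnZ (le_trans (ler_wpM2l (cmod_ge0 _) (mxnB _ _)))// mulrDr lerD//.
    by rewrite -[leRHS]mul1r ler_pM ?cmod_ge0 ?mxn_ge0// mxnM.
  rewrite (le_trans (ler_wpM2l (cmod_ge0 _) (mxnM _ _)))// mulrA.
  by rewrite ler_wpM2r// mxn_ge0.
rewrite (le_trans (mxnB _ _))// mulrDl lerD ?mxnM//.
rewrite (le_trans (mxnM _ _))// [2 * _]mulrC -!mulrA ler_wpM2l ?mxn_ge0//.
by rewrite mulrA.
Qed.

(** An eigenvector x at s would have P x = 0, so x = - (s - p) T x, of at most half the norm of
    x. *)
Lemma near_pole_regular n (A P T : 'M[C]_n) (p s : C) :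
  P *m (p%:M - A) = 0 -> T *m (p%:M - A) = 1%:M - P ->
  s != p -> cmod (s - p) * mxn T <= 2^-1 -> ~~ root (char_poly A) s.
Proof.
move=> PA TA sp hT; apply/negP => /char_poly_root_col[x x0 Ax].
have E : (s%:M - A) *m x = 0 by rewrite mulmxBl mul_scalar_mx Ax subrr.
have [] := resolvent_near_pole PA TA E; rewrite !mulmx0 => /eqP.
rewrite scalemx_eq0 subr_eq0 (negPf sp) /= => /eqP -> ; rewrite !add0r => Ex.
have : mxn x <= 2^-1 * mxn x.
  rewrite {1}Ex mxnN mxnZ (le_trans (ler_wpM2l (cmod_ge0 _) (mxnM _ _)))//.
  by rewrite mulrA ler_wpM2r// mxn_ge0.
have : 0 < mxn x by rewrite mxn_gt0.
lra.
Qed.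

End Resolvent.

Section TransferLimits.
Variables (R : realType) (m : nat).
Local Notation C := R[i].
Implicit Types G : tfmx R m.

Lemma tfeval_solve G n (S : state_space R n m) (s : C) :
  transfer S = G -> ~~ root (char_poly (cA S)) s ->
  exists X : 'M[C]_(n, m), (s%:M - cA S) *m X = cB S /\
    tfeval G s = cC S *m X + cD S.
Proof.
move=> ES s0; have [_ ->] := tfeval_transfer ES s0.
exists (invmx (s%:M - cA S) *m cB S); rewrite !mulmxA; split => //.
by rewrite mulmxV ?mul1mx// unitmxE unitfE -char_poly_eval.
Qed.

Lemma tfeval_infty G n (S : state_space R n m) (e : R) : transfer S = G -> 0 < e ->
  exists M : R, forall s, M < cmod s ->
    ~~ root (char_poly (cA S)) s /\ mxn (tfeval G s - cD S) < e.
Proof.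
(* Beyond |A| there is no eigenvalue, and |C X| <= |C| |B| / (|s| - |A|), which is below e once |s|
   > |A| + b. *)
move=> ES e0; pose b := mxn (cC S) * mxn (cB S) / e.
have b0 : 0 <= b by rewrite divr_ge0 ?mulr_ge0 ?mxn_ge0// ltW.
exists (mxn (cA S) + b) => s sM.
have sA : mxn (cA S) < cmod s by rewrite (le_lt_trans _ sM)// lerDl.
have s0 : ~~ root (char_poly (cA S)) s.
  apply/negP => /char_poly_root_col[x x0 Ax].
  by have := mxn_scalar Ax x0; rewrite leNgt sA.
split => //; have [X [EX ->]] := tfeval_solve ES s0; rewrite addrK.
have := resolvent_infty EX; have := mxnM (cC S) X.
have := mxn_ge0 X; have := mxn_ge0 (cC S); have := mxn_ge0 (cB S).
move: sM; rewrite -ltrBDl; rewrite /b ltr_pdivrMr//.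
set d := cmod s - _; have d0 : 0 < d by rewrite subr_gt0.
move: (mxn X) (mxn (cC S)) (mxn (cB S)) (mxn (cC S *m X)) => x c bb y H1 bb0 c0 x0 yc dx.
rewrite -(ltr_pM2l d0) (le_lt_trans _ H1)//.
rewrite (@le_trans _ _ (d * (c * x))) ?ler_wpM2l ?(ltW d0)//.
by rewrite mulrCA ler_wpM2l.
Qed.

Lemma tfinftyE G n (S : state_space R n m) : transfer S = G -> tfinfty G = cD S.
Proof.
move=> ES; apply: lim_mxE => e e0.
have [M HM] := tfeval_infty ES e0.
by exists M => s; rewrite cmodE ltcR => /HM[].
Qed.

(** With h = s - p and h X = P B + h Y, the distance to the limit is h (C P B + s (C Y + D)), which
    is O(h) as Y is bounded. *)
Lemma residue_lim G n (S : state_space R n m) (P T : 'M[C]_n) (p : C) :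
  transfer S = G ->
  P *m (p%:M - cA S) = 0 -> T *m (p%:M - cA S) = 1%:M - P ->
  lim (((s - p) * s) *: tfeval G s @[s --> p^']) = p *: (cC S *m P *m cB S).
Proof.
move=> ES PA TA; apply: lim_mxE => e e0.
set A := cA S in PA TA *; set B := cB S; set Cm := cC S; set D := cD S.
pose K0 := (mxn T + 2 * mxn T * (mxn P + mxn T)) * mxn B.
have K00 : 0 <= K0.
  by rewrite mulr_ge0 ?addr_ge0 ?mulr_ge0 ?addr_ge0 ?mxn_ge0.
pose K := mxn (Cm *m P *m B) + (cmod p + 1) * (mxn Cm * K0 + mxn D) + 1.
have K1 : 0 < K.
  rewrite ltr_wpDl// addr_ge0 ?mxn_ge0// mulr_ge0 ?addr_ge0 ?cmod_ge0 ?mxn_ge0//.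
  by rewrite mulr_ge0 ?mxn_ge0.
have T1 : 0 < 2 * mxn T + 1 by rewrite ltr_wpDl// mulr_ge0// mxn_ge0.
pose d := Num.min 1 (Num.min (2 * mxn T + 1)^-1 (e / K)).
have d0 : 0 < d by rewrite !lt_min ltr01 invr_gt0 T1 divr_gt0.
rewrite /dnbhs /within /=; apply/nbhs_ballP; exists d%:C; first by rewrite /= ltcR.
move=> s; rewrite /ball/= /ball_ distrC cmodE ltcR => sd /= sp.
move: sd; rewrite !lt_min => /and3P[h1 hT hK].
have {}hT : cmod (s - p) * mxn T <= 2^-1.
  have := cmod_ge0 (s - p); have := mxn_ge0 T; move: hT.
  rewrite -[_^-1]mul1r ltr_pdivlMr//; nra.
have [X [EX ->]] := tfeval_solve ES (near_pole_regular PA TA sp hT).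
have [Y [hX Yb]] := resolvent_near_pole_bound PA TA EX (ltW h1) hT.
have -> : ((s - p) * s) *: (Cm *m X + D) - p *: (Cm *m P *m B) =
    (s - p) *: (Cm *m P *m B + s *: (Cm *m Y + D)).
  rewrite mulrC -scalerA scalerDr scalemxAr hX mulmxDr -/B -scalemxAr mulmxA.
  rewrite -{2}[s](subrK p) -/Cm.
  set M1 := Cm *m P *m B; set M2 := Cm *m Y.
  rewrite !scalerDr !scalerA; apply/matrixP => i j; rewrite !mxE; ring.
have sp1 : cmod s <= cmod p + 1.
  by rewrite -[s](subrK p) addrC (le_trans (cmodD _ _))// lerD2l ltW.
rewrite mxnZ; apply: (@le_lt_trans _ _ (cmod (s - p) * K)).
  rewrite ler_wpM2l ?cmod_ge0// (le_trans (mxnD _ _))// /K -addrA lerD2l.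
  rewrite (@le_trans _ _ ((cmod p + 1) * (mxn Cm * K0 + mxn D))) ?lerDl//.
  rewrite mxnZ ler_pM ?cmod_ge0 ?mxn_ge0// (le_trans (mxnD _ _))// lerD2r.
  by rewrite (le_trans (mxnM _ _))// ler_wpM2l ?mxn_ge0.
by rewrite -ltr_pdivlMr.
Qed.

End TransferLimits.

(** * Hermitian forms *)

Section HermitianForms.
Variable R : realType.
Local Notation C := R[i].

Definition dot n (v w : 'cV[C]_n) : C := (v ^t* *m w) 0 0.

Lemma dotDr n (u v w : 'cV_n) : dot u (v + w) = dot u v + dot u w.
Proof. by rewrite /dot mulmxDr mxE. Qed.

Lemma dotBr n (u v w : 'cV_n) : dot u (v - w) = dot u v - dot u w.
Proof. by rewrite /dot mulmxBr !mxE. Qed.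

Lemma dotZr n (u v : 'cV_n) a : dot u (a *: v) = a * dot u v.
Proof. by rewrite /dot -scalemxAr mxE. Qed.

Lemma dotC n (u v : 'cV_n) : dot v u = (dot u v)^*.
Proof.
rewrite /dot !mxE rmorph_sum; apply: eq_bigr => i _.
by rewrite !mxE rmorphM /= !conjCE conjcK mulrC.
Qed.

Lemma cmod_dot n (u v : 'cV_n) : cmod (dot u v) <= mxn u * mxn v.
Proof. by rewrite (le_trans (mxn_entry _ _ _))// (le_trans (mxnM _ _))// mxn_adj. Qed.

Lemma dot_adj n (M : 'M_n) (u v : 'cV_n) : dot u (M ^t* *m v) = dot (M *m u) v.
Proof. by rewrite /dot trmx_mul map_mxM mulmxA. Qed.

Lemma Im_conjc (z : C) : complex.Im z^* = - complex.Im z.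
Proof. by case: z. Qed.

Lemma Im_realM (x : R) (z : C) : complex.Im (x%:C * z) = x * complex.Im z.
Proof. by case: z => a b /=; rewrite mul0r addr0. Qed.

Lemma Re_realM (x : R) (z : C) : complex.Re (x%:C * z) = x * complex.Re z.
Proof. by case: z => a b /=; rewrite mul0r subr0. Qed.

(** For a = v* G v the form is j (a - conj a) = -2 Im a, so both frequency conditions become sign
    conditions on Im (v* G v). *)
Lemma jdiff_form m (G : tfmx R m) (w : R) (v : 'cV_m) :
  (v ^t* *m jdiff G w *m v) 0 0 =
  (- 2 * complex.Im (dot v (tfeval G (jw w) *m v)))%:C.
Proof.
rewrite /jdiff; set M := tfeval G (jw w).
rewrite -scalemxAr -scalemxAl mxE -mulmxA mulmxBl.
rewrite -[(v ^t* *m _) 0 0]/(dot v _) dotBr dot_adj [dot (M *m v) v]dotC.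
case: (dot v _) => a b; apply/eqP; rewrite eq_complex /=.
by apply/andP; split; apply/eqP; ring.
Qed.

Lemma psd_jdiff m (G : tfmx R m) (w : R) : psdmx (jdiff G w) ->
  forall v, complex.Im (dot v (tfeval G (jw w) *m v)) <= 0.
Proof.
move=> [_ H] v; move: (H v); rewrite jdiff_form ler0c; lra.
Qed.

(** Cauchy-Schwarz up to a factor 2, enough to compare the l1 and l2 norms. *)
Lemma sqr_sum_le (I : finType) (a : I -> R) :
  (\sum_i a i) ^+ 2 <= 2 * #|I|%:R * \sum_i a i ^+ 2.
Proof.
rewrite expr2 big_distrl /=.
apply: (@le_trans _ _ (\sum_i \sum_j (a i ^+ 2 + a j ^+ 2))).
  apply: ler_sum => i _; rewrite big_distrr /=; apply: ler_sum => j _.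
  by have := sqr_ge0 (a i - a j); have := sqr_ge0 (a i + a j); rewrite !expr2; nra.
rewrite (eq_bigr (fun i => #|I|%:R * a i ^+ 2 + \sum_j a j ^+ 2)); last first.
  by move=> i _; rewrite big_split /= sumr_const mulr_natl.
rewrite big_split /= -mulr_sumr sumr_const -[(\sum_j _) *+ _]mulr_natl.
by rewrite -mulrDl -mulr2n -[(_ *+ 2)]mulr_natl.
Qed.

Lemma diag_form n (d : 'rV[C]_n) (w : 'cV[C]_n) :
  (w ^t* *m diag_mx d *m w) 0 0 = \sum_i d 0 i * (cmod (w i 0) ^+ 2)%:C.
Proof.
rewrite mul_mx_diag [LHS]mxE; apply: eq_bigr => i _; rewrite !mxE.
rewrite (rmorphXn (real_complex R)) /= -cmodE sqr_normc conjCE; ring.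
Qed.

(** Uniform positivity through the spectral theorem: all eigenvalues are bounded below, and the norm
    of P v controls that of v. *)
Lemma pdmx_margin n (Q : 'M[C]_n) : pdmx Q ->
  exists2 k : R, 0 < k & forall v : 'cV_n, k * mxn v ^+ 2 <= complex.Re ((v ^t* *m Q *m v) 0 0).
Proof.
move=> [Qh Qpd].
pose P := spectralmx Q; pose d := spectral_diag Q.
have EQ : Q = invmx P *m diag_mx d *m P.
  exact/orthomx_spectralP/hermitian_normalmx.
have PU : P \is unitarymx := spectral_unitarymx Q.
have Pu : P \in unitmx := unitarymx_unit PU.
have form (v : 'cV_n) : (v ^t* *m Q *m v) 0 0 =
    \sum_i d 0 i * (cmod ((P *m v) i 0) ^+ 2)%:C.
  rewrite EQ (invmx_unitary PU) !mulmxA -mulmxA -map_mxM -trmx_mul.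
  exact: diag_form.
have dpos i : 0 < complex.Re (d 0 i).
  pose v : 'cV_n := invmx P *m delta_mx i 0.
  have v0 : v != 0.
    apply/negP => /eqP v0; have : P *m v = delta_mx i 0 by rewrite mulKVmx.
    by rewrite v0 mulmx0 => /matrixP/(_ i 0); rewrite !mxE !eqxx /= => /eqP; rewrite eq_sym oner_eq0.
  have := Qpd v v0; rewrite form mulKVmx// (bigD1 i)//= big1 => [|j /negPf ji].
    by rewrite !mxE !eqxx cmod1 expr1n mulr1 addr0 ltcE => /andP[].
  by rewrite !mxE ji cmod0 expr0n mulr0.
(* Its inverse is a positive lower bound of all eigenvalues, also when n = 0. *)
pose s := 1 + \sum_i (complex.Re (d 0 i))^-1.
have s0 : 0 < s by rewrite ltr_wpDr// sumr_ge0// => i _; rewrite invr_ge0 ltW.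
have sd i : s^-1 <= complex.Re (d 0 i).
  rewrite invf_ple// ?posrE//.
  rewrite /s (bigD1 i)//= addrCA lerDl addr_ge0// sumr_ge0// => j _.
  by rewrite invr_ge0 ltW.
pose N := mxn (invmx P) ^+ 2 * (2 * n%:R) + 1.
have N0 : 0 < N by rewrite ltr_wpDl// mulr_ge0 ?sqr_ge0 ?mulr_ge0.
exists (s^-1 / N); first by rewrite divr_gt0// invr_gt0.
move=> v; set S := \sum_i cmod ((P *m v) i 0) ^+ 2.
have S0 : 0 <= S by apply: sumr_ge0 => i _; exact: sqr_ge0.
have vS : mxn v ^+ 2 <= N * S.
  have : mxn v <= mxn (invmx P) * mxn (P *m v) by rewrite -{1}(mulKmx Pu v) mxnM.
  have wS : mxn (P *m v) ^+ 2 <= 2 * n%:R * S.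
    have := sqr_sum_le (fun i => cmod ((P *m v) i 0)); rewrite card_ord; apply: le_trans.
    by rewrite /mxn; under eq_bigr do rewrite big_ord1.
  move=> vP; rewrite (@le_trans _ _ ((mxn (invmx P) * mxn (P *m v)) ^+ 2))//.
    by rewrite ler_sqr ?nnegrE ?mulr_ge0 ?mxn_ge0.
  rewrite exprMn (@le_trans _ _ (mxn (invmx P) ^+ 2 * (2 * n%:R * S)))//.
    by rewrite ler_wpM2l// sqr_ge0.
  by rewrite [N * S]mulrDl mul1r !mulrA lerDl.
rewrite form raddf_sum /= (@le_trans _ _ (s^-1 * S))//.
  by rewrite -mulrA ler_wpM2l ?invr_ge0 ?(ltW s0)// mulrC ler_pdivrMr// mulrC.
rewrite /S big_distrr /=; apply: ler_sum => i _.
by rewrite [X in complex.Re X]mulrC Re_realM mulrC ler_wpM2l ?sqr_ge0.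
Qed.

Lemma pd_jdiff m (G : tfmx R m) (w : R) : pdmx (jdiff G w) ->
  exists2 k : R, 0 < k & forall v : 'cV_m,
    complex.Im (dot v (tfeval G (jw w) *m v)) <= - (k * mxn v ^+ 2).
Proof.
move=> /pdmx_margin[k k0 H]; exists (k / 2); first by rewrite divr_gt0.
move=> v; move: (H v); rewrite jdiff_form /=; lra.
Qed.

Lemma le0_of_le_eps (a K : R) : (forall e : R, 0 < e -> a <= K * e) -> a <= 0.
Proof.
move=> H; apply/ler_addgt0Pr => e e0; rewrite add0r.
have K0 : 0 < `|K| + 1 by rewrite ltr_wpDl.
rewrite (le_trans (H (e / (`|K| + 1)) _)) ?divr_gt0// mulrCA.
rewrite ler_piMr ?(ltW e0)// ler_pdivrMr// mul1r (le_trans (ler_norm K))//.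
by rewrite lerDl.
Qed.

(** As w grows, the sign condition passes to Im (v* D v) <= 0. The hypothesis is the non-strict
    inequality off the poles, which both classes of systems provide. *)
Lemma feedthrough_sym m (G : tfmx R m) n (S : state_space R n m) :
  transfer S = G ->
  (forall w : R, 0 < w -> ~ tfpole G (jw w) -> forall v,
     complex.Im (dot v (tfeval G (jw w) *m v)) <= 0) ->
  (cD S)^T = cD S.
Proof.
move=> ES H.
have D0 v : complex.Im (dot v (cD S *m v)) <= 0.
  apply: (@le0_of_le_eps _ (mxn v * mxn v)) => e e0.
  have [M HM] := tfeval_infty ES e0.
  pose w := `|M| + 1.
  have w0 : 0 < w by rewrite ltr_wpDl.
  have [|r Hr] := HM (jw w).
    rewrite (lt_le_trans _ (Im_le_cmod _))//= ger0_norm ?(ltW w0)//.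
    by rewrite (le_lt_trans (ler_norm M))// ltrDl.
  have np := (tfeval_transfer ES r).1.
  have := H w w0 np v.
  rewrite -[X in X *m v](subrK (cD S)) mulmxDl dotDr raddfD /= => Hw.
  have : `|complex.Im (dot v ((tfeval G (jw w) - cD S) *m v))| <= mxn v * mxn v * e.
    rewrite (le_trans (Im_le_cmod _))// (le_trans (cmod_dot _ _))// -mulrA ler_wpM2l ?mxn_ge0//.
    by rewrite (le_trans (mxnM _ _))// mulrC ler_wpM2l ?mxn_ge0// ltW.
  rewrite ler_norml => /andP[H1 _].
  have aux (a b c : R) : a + b <= 0 -> - c <= a -> b <= c.
    by move=> h1 h2; rewrite (@le_trans _ _ (- a))// ?(lerNl a)// -subr_le0 opprK addrC.
  exact: aux Hw H1.
have le i k : complex.Re (cD S i k) <= complex.Re (cD S k i).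
  have [->//|ik] := eqVneq i k.
  have ed (a b : 'I_m) (M : 'M[C]_m) : dot (delta_mx a 0) (M *m delta_mx b 0) = M a b.
    rewrite /dot mulmxA trmx_delta.
    have -> : (delta_mx 0 a : 'rV[C]_m) ^ Num.conj = delta_mx 0 a.
      by apply/matrixP => x y; rewrite !mxE; case: (_ && _); rewrite ?rmorph1 ?rmorph0.
    by rewrite -rowE -colE !mxE.
  (* D is real, so Im (v* D v) = D i k - D k i for this v. *)
  pose v : 'cV[C]_m := delta_mx i 0 + 'i *: delta_mx k 0.
  have := D0 v; rewrite /v mulmxDr dotDr -scalemxAr dotZr.
  rewrite dotC [X in _ + _ * X]dotC !dotDr !dotZr.
  rewrite -![dot (_ *m _) _]dot_adj !ed.
  by rewrite !mxE /=; lra.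
apply/matrixP => i k; rewrite mxE.
have := le i k; have := le k i; rewrite !mxE /= => h1 h2.
by congr (_ %:C); apply/le_anti; rewrite h1 h2.
Qed.

End HermitianForms.

(** * The scaled interconnection *)

Section ModalTests.
Variables (R : realType) (m : nat).
Local Notation C := R[i].
Local Notation RC := (real_complex R).
Implicit Types G : tfmx R m.

(** The Popov-Belevitch-Hautus test: the real rows v with v x = 0 include those of C and are stable
    under A, so every unit row kills x. *)
Lemma observable_mode G n (S : state_space R n m) (l : C) (x : 'cV[C]_n) :
  minimal_realization G S ->
  (l%:M - cA S) *m x = 0 -> cC S *m x = 0 -> x = 0.
Proof.
move=> Smin /eqP; rewrite mulmxBl mul_scalar_mx subr_eq0 => /eqP Ax Cx.
have H : forall v : 'rV[R]_n, map_mx RC v *m x = 0.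
  apply: (observable_ind Smin) => [|a u v Hu Hv|v Hv|i].
  - by rewrite map_mx0 mul0mx.
  - by rewrite map_mxD map_mxZ mulmxDl -scalemxAl Hu Hv scaler0 addr0.
  - by rewrite map_mxM -mulmxA -/(cA S) -Ax -scalemxAr Hv scaler0.
  - by rewrite map_row -row_mul -/(cC S) Cx row0.
apply/row_matrixP => i; rewrite row0 rowE -(H (delta_mx 0 i)); congr (_ *m _).
by apply/matrixP => a b; rewrite !mxE; case: (_ && _); rewrite ?rmorph1 ?rmorph0.
Qed.

Lemma controllable_mode G n (S : state_space R n m) (l : C) (y : 'rV[C]_n) :
  minimal_realization G S ->
  y *m (l%:M - cA S) = 0 -> y *m cB S = 0 -> y = 0.
Proof.
move=> /minimal_tr Smin yA yB; apply: trmx_inj; rewrite trmx0.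
apply: (observable_mode (l := l) Smin).
  rewrite -[cA _]map_trmx -[X in X - _]tr_scalar_mx -linearB -trmx_mul.
  by rewrite -/(cA S) yA trmx0.
by rewrite -[cC _]map_trmx -trmx_mul -/(cB S) yB trmx0.
Qed.

Lemma residue_psd G n (S : state_space R n m) (w : R) :
  minimal_realization G S -> negative_imaginary G -> 0 < w ->
  root (char_poly (cA S)) (jw w) ->
  exists P T : 'M[C]_n,
    [/\ P *m ((jw w)%:M - cA S) = 0, T *m ((jw w)%:M - cA S) = 1%:M - P
      & psdmx (jw w *: (cC S *m P *m cB S))].
Proof.
move=> Smin [_ _ N3] w0 rw.
have pw : tfpole G (jw w).
  apply: contrapT => np; move: rw; apply/negP.
  exact: no_pole_no_eigenvalue Smin np.
have [[_ ord] psd] := N3 w w0 pw.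
have [P [T [PA TA]]] := simple_pole_projector Smin ord.
exists P, T; split; [exact: PA | exact: TA |].
by rewrite -(residue_lim Smin.1 PA TA).
Qed.

(** If jw is an eigenvalue of A, then u does not determine x, and G(jw) has no value. The output is
    then compared with the response to the same u at the nearby regular frequency w + h. *)
Lemma negative_imaginary_axis G n (S : state_space R n m) (w : R)
    (x : 'cV[C]_n) (u : 'cV[C]_m) :
  minimal_realization G S -> negative_imaginary G -> 0 < w ->
  ((jw w)%:M - cA S) *m x = cB S *m u ->
  complex.Im (dot u (cC S *m x + cD S *m u)) <= 0.
Proof.
move=> Smin GNI w0 Ex; have [_ N2 _] := GNI.
have nonpole (v : R) (y : 'cV[C]_n) : 0 < v -> ~~ root (char_poly (cA S)) (jw v) ->
    ((jw v)%:M - cA S) *m y = cB S *m u ->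
    complex.Im (dot u (cC S *m y + cD S *m u)) <= 0.
  move=> v0 rv Ey; have [np Etf] := tfeval_transfer Smin.1 rv.
  have -> : cC S *m y + cD S *m u = tfeval G (jw v) *m u.
    rewrite Etf mulmxDl; congr (_ + _); rewrite -!mulmxA -Ey; congr (_ *m _).
    by rewrite mulKmx// unitmxE unitfE -char_poly_eval.
  exact/psd_jdiff/N2.
have [rw|rw] := boolP (root (char_poly (cA S)) (jw w)); last exact: nonpole Ex.
have [P [T [PA TA [Kh Kpsd]]]] := residue_psd Smin GNI w0 rw.
set p := jw w in rw Ex PA TA Kh Kpsd *.
set K0 := p *: _ in Kh Kpsd.
have p0 : p != 0 by rewrite /p eq_complex /= (gt_eqF w0) andbF.
(* At s = p the identities read P B u = 0 and x = P x + T B u. *)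
have [] := resolvent_near_pole PA TA Ex.
rewrite subrr !scale0r subr0 => /esym PBu xE.
have Ku : K0 *m u = 0.
  by rewrite /K0 -scalemxAl -mulmxA -mulmxA PBu mulmx0 scaler0.
have uK : u ^t* *m K0 = 0.
  have EK : K0 = K0 ^t*.
    by move/is_hermitianmxP: Kh; rewrite expr0 scale1r.
  by rewrite EK -map_mxM -trmx_mul Ku trmx0 map_mx0.
(* This row is annihilated by p - A, and by B because p u* C P B = u* K0 = 0: an uncontrollable
   mode. *)
have uCP : u ^t* *m cC S *m P = 0.
  apply: (controllable_mode (l := p) Smin); first by rewrite -!mulmxA PA !mulmx0.
  apply/eqP; rewrite -(inj_eq (scalerI p0)) scaler0 -uK /K0 -scalemxAr !mulmxA.
  exact/eqP.
have dCP y : dot u (cC S *m (P *m y)) = 0.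
  by rewrite /dot !mulmxA uCP mul0mx mxE.
set g := dot u (cC S *m (T *m (cB S *m u)) + cD S *m u).
have -> : dot u (cC S *m x + cD S *m u) = g.
  by rewrite /g xE mulmxDr !dotDr dCP add0r.
(* [K] bounds u* C T y uniformly near w; [K * h] is the error in replacing the response at w + h by
   [g]. *)
pose K := mxn u * (mxn (cC S) * (mxn T * ((mxn T + 2 * mxn T * (mxn P + mxn T)) * mxn (cB S *m u)))).
have T1 : 0 < 2 * mxn T + 1 by rewrite ltr_wpDl// mulr_ge0// mxn_ge0.
apply: (@le0_of_le_eps _ _ K) => e e0.
pose h := Num.min e (Num.min 1 (2 * mxn T + 1)^-1).
have h0 : 0 < h by rewrite !lt_min e0 ltr01 invr_gt0.
have he : h <= e by rewrite ge_min lexx.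
have h1 : h <= 1 by rewrite !ge_min lexx orbT.
have hT : h <= (2 * mxn T + 1)^-1 by rewrite !ge_min lexx !orbT.
have Ep : jw (w + h) - p = jw h.
  by rewrite /p /jw; apply/eqP; rewrite eq_complex /= subrr eqxx addrC addKr eqxx.
have ch : cmod (jw (w + h) - p) = h.
  rewrite Ep; apply/eqP; rewrite -(eqrXn2 (ltn0Sn 1)) ?cmod_ge0 ?(ltW h0)//.
  by rewrite cmod_sqr /= expr0n add0r.
have {}hT : cmod (jw (w + h) - p) * mxn T <= 2^-1.
  have := mxn_ge0 T; move: hT; rewrite ch -[_^-1]mul1r ler_pdivlMr//; nra.
have sp : jw (w + h) != p by rewrite -subr_eq0 Ep eq_complex /= (gt_eqF h0) andbF.
have rs := near_pole_regular PA TA sp hT.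
have U : (jw (w + h))%:M - cA S \in unitmx by rewrite unitmxE unitfE -char_poly_eval.
pose y := invmx ((jw (w + h))%:M - cA S) *m (cB S *m u).
have Ey : ((jw (w + h))%:M - cA S) *m y = cB S *m u by rewrite mulKVmx.
have := nonpole _ y (addr_gt0 w0 h0) rs Ey.
(* P B u = 0 gives P y = 0, so y = T B u - j h T y has no polar part. *)
have [] := resolvent_near_pole PA TA Ey.
rewrite PBu => /eqP; rewrite scalemx_eq0 subr_eq0 (negPf sp) /= => /eqP Py yE.
have [|Y [hy Yb]] := resolvent_near_pole_bound PA TA Ey _ hT; first by rewrite ch.
have yY : y = Y.
  move: hy; rewrite PBu add0r; apply: scalerI.
  by rewrite subr_eq0.
rewrite [X in cC S *m X]yE Py add0r mulmxBr addrAC dotBr -/g raddfB /= subr_le0.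
move=> /le_trans; apply; rewrite (le_trans (ler_norm _))// (le_trans (Im_le_cmod _))//.
rewrite -scalemxAr dotZr cmodM ch mulrC ler_pM ?cmod_ge0 ?(ltW h0)//.
rewrite (le_trans (cmod_dot _ _))// /K ler_wpM2l ?mxn_ge0//.
rewrite (le_trans (mxnM _ _))// ler_wpM2l ?mxn_ge0//.
by rewrite (le_trans (mxnM _ _))// ler_wpM2l ?mxn_ge0// yY.
Qed.

End ModalTests.

(** * Loop signals of the pencil and absence of imaginary eigenvalues *)

Section Interconnection.
Variables (R : realType) (m : nat).
Local Notation C := R[i].
Local Notation RC := (real_complex R).
Implicit Types G H : tfmx R m.

(* pencil0 + t pencil1 is the closed-loop matrix of G and t H. *)
Definition pencil0 n1 n2 (S1 : state_space R n1 m) (S2 : state_space R n2 m) :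
    'M[C]_(n1 + n2) :=
  block_mx (cA S1) 0 (cB S2 *m cC S1) (cA S2).

Definition pencil1 n1 n2 (S1 : state_space R n1 m) (S2 : state_space R n2 m) :
    'M[C]_(n1 + n2) :=
  block_mx (cB S1 *m cD S2 *m cC S1) (cB S1 *m cC S2)
           0 (cB S2 *m cD S1 *m cC S2).

Lemma closed_loop_pencil n1 n2 (S1 : state_space R n1 m) (S2 : state_space R n2 m) :
  map_mx RC (closed_loop S1 S2) = pencil0 S1 S2 + pencil1 S1 S2.
Proof.
by rewrite /closed_loop map_block_mx !map_mxD !map_mxM add_block_mx add0r addr0.
Qed.

Lemma pencil_signals n1 n2 (S1 : state_space R n1 m) (S2 : state_space R n2 m)
    (t l : C) :
  cD S1 *m cD S2 = 0 -> cD S2 *m cD S1 = 0 ->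
  root (char_poly (pencil0 S1 S2 + t *: pencil1 S1 S2)) l ->
  exists (x1 : 'cV[C]_n1) (x2 : 'cV[C]_n2) (u1 u2 : 'cV[C]_m),
    [/\ (l%:M - cA S1) *m x1 = cB S1 *m u1, (l%:M - cA S2) *m x2 = cB S2 *m u2,
        u2 = cC S1 *m x1 + cD S1 *m u1, u1 = t *: (cC S2 *m x2 + cD S2 *m u2)
      & (x1 != 0) || (x2 != 0)].
Proof.
move=> D12 D21 /char_poly_root_col[x x0].
rewrite -[x]vsubmxK /pencil0 /pencil1; set x1 := usubmx x; set x2 := dsubmx x.
rewrite scale_block_mx add_block_mx mul_block_col scale_col_mx.
move=> /eq_col_mx[E1 E2].
(* As D1 D2 = D2 D1 = 0, the algebraic loop closes after one substitution. *)
pose u1 := t *: (cC S2 *m x2 + cD S2 *m (cC S1 *m x1)).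
pose u2 := cC S1 *m x1 + t *: (cD S1 *m (cC S2 *m x2)).
exists x1, x2, u1, u2; split.
- rewrite mulmxBl mul_scalar_mx -E1 add0r mulmxDl addrC !addrA addNr add0r.
  by rewrite /u1 -!scalemxAl -scalerDr -scalemxAr mulmxDr addrC !mulmxA.
- rewrite mulmxBl mul_scalar_mx -E2 scaler0 addr0 mulmxDl [cA S2 *m x2 + _]addrC !addrA addrK.
  by rewrite /u2 mulmxDr -scalemxAl -scalemxAr !mulmxA.
- by rewrite /u2 /u1 -scalemxAr mulmxDr !mulmxA D12 !mul0mx addr0.
- by rewrite /u1 /u2 mulmxDr -scalemxAr [cD S2 *m (cD S1 *m _)]mulmxA D21 mul0mx scaler0 addr0.
- rewrite -negb_and; apply: contra x0 => /andP[/eqP a0 /eqP b0].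
  by rewrite -[x]vsubmxK -/x1 -/x2 a0 b0 col_mx0.
Qed.

Lemma sni_regular H n (S : state_space R n m) (l : C) :
  minimal_realization H S -> strictly_negative_imaginary H ->
  0 <= complex.Re l -> ~~ root (char_poly (cA S)) l.
Proof. by move=> Smin [H1 _] l0; apply: no_pole_no_eigenvalue Smin (H1 l l0). Qed.

(** Here H is regular at l. If u2 = 0, then u1 = 0 and x2 = 0, so x1 would be an unobservable mode
    of the first system and vanish too. *)
Lemma pencil_signals_rhp G H n1 n2 (S1 : state_space R n1 m) (S2 : state_space R n2 m)
    (t l : C) :
  minimal_realization G S1 -> minimal_realization H S2 ->
  strictly_negative_imaginary H ->
  cD S1 *m cD S2 = 0 -> cD S2 *m cD S1 = 0 -> 0 <= complex.Re l ->
  root (char_poly (pencil0 S1 S2 + t *: pencil1 S1 S2)) l ->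
  exists (x1 : 'cV[C]_n1) (x2 : 'cV[C]_n2) (u1 u2 : 'cV[C]_m),
    [/\ (l%:M - cA S1) *m x1 = cB S1 *m u1, u2 = cC S1 *m x1 + cD S1 *m u1,
        (l%:M - cA S2) *m x2 = cB S2 *m u2 /\ cC S2 *m x2 + cD S2 *m u2 = tfeval H l *m u2,
        u1 = t *: (tfeval H l *m u2) & u2 != 0].
Proof.
move=> min1 min2 HSNI D12 D21 l0 rl.
have [x1 [x2 [u1 [u2 [E1 E2 Eu2 Eu1 x0]]]]] := pencil_signals D12 D21 rl.
have r2 := sni_regular min2 HSNI l0.
have U : l%:M - cA S2 \in unitmx by rewrite unitmxE unitfE -char_poly_eval.
have [_ EH] := tfeval_transfer min2.1 r2.
have Hx : cC S2 *m x2 + cD S2 *m u2 = tfeval H l *m u2.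
  by rewrite EH mulmxDl -!mulmxA -E2 mulKmx.
exists x1, x2, u1, u2; split => //; first by rewrite -Hx.
apply/negP => /eqP u20.
have u10 : u1 = 0 by rewrite Eu1 Hx u20 mulmx0 scaler0.
have x20 : x2 = 0 by rewrite -(mulKmx U x2) E2 u20 !mulmx0.
move: x0; rewrite x20 eqxx orbF => /negP; apply; apply/eqP.
apply: (observable_mode (l := l) min1); first by rewrite E1 u10 mulmx0.
by move: Eu2; rewrite u20 u10 mulmx0 addr0.
Qed.

Lemma root_conj_real n (M : 'M[R]_n) (l : C) :
  root (char_poly (map_mx RC M)) l -> root (char_poly (map_mx RC M)) l^*.
Proof.
rewrite -map_char_poly; set q := char_poly M.
have E : map_poly (@conjc R) (map_poly RC q) = map_poly RC q.
  by rewrite -map_poly_comp; apply: eq_map_poly => a; exact: conjc_real.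
by rewrite /root -{2}E horner_map conjc_eq0.
Qed.

(** The frequency conditions concern w > 0 only; conjugation covers the lower half of the axis. *)
Lemma pencil_root_conj n1 n2 (S1 : state_space R n1 m) (S2 : state_space R n2 m)
    (t : R) (l : C) :
  root (char_poly (pencil0 S1 S2 + t%:C *: pencil1 S1 S2)) l ->
  root (char_poly (pencil0 S1 S2 + t%:C *: pencil1 S1 S2)) l^*.
Proof.
pose M0 := block_mx (ssA S1) 0 (ssB S2 *m ssC S1) (ssA S2).
pose M1 := block_mx (ssB S1 *m ssD S2 *m ssC S1) (ssB S1 *m ssC S2)
                    0 (ssB S2 *m ssD S1 *m ssC S2).
have -> : pencil0 S1 S2 + t%:C *: pencil1 S1 S2 = map_mx RC (M0 + t *: M1).
  by rewrite map_mxD map_mxZ !map_block_mx !map_mxM !map_mx0.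
exact: root_conj_real.
Qed.

Lemma lambda_max_eigenvalue (M : 'M[C]_m) (x : R) (v : 'cV[C]_m) :
  v != 0 -> M *m v = x%:C *: v -> x <= lambda_max M.
Proof.
move=> v0 Mv; apply: sup_upper_bound.
  split; first by exists x; rewrite /= eigenvalue_root_char; apply/char_poly_root_col; exists v.
  exists (mxn M) => y; rewrite /= eigenvalue_root_char => /char_poly_root_col[z z0 Mz].
  by rewrite (le_trans (ler_norm y))// -cmod_real (mxn_scalar Mz).
by rewrite /= eigenvalue_root_char; apply/char_poly_root_col; exists v.
Qed.

Lemma pencil_axis G H n1 n2 (S1 : state_space R n1 m) (S2 : state_space R n2 m)
    (t : R) (l : C) :
  minimal_realization G S1 -> minimal_realization H S2 ->
  negative_imaginary G -> strictly_negative_imaginary H ->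
  cD S1 *m cD S2 = 0 -> cD S2 *m cD S1 = 0 ->
  lambda_max (tfeval G 0 *m tfeval H 0) < 1 ->
  0 < t <= 1 -> root (char_poly (pencil0 S1 S2 + t%:C *: pencil1 S1 S2)) l ->
  complex.Re l <> 0.
Proof.
move=> min1 min2 GNI HSNI D12 D21 lam /andP[t0 t1].
wlog l0 : l / 0 <= complex.Im l => [IH|] rl Rl.
  have [/IH|l0] := leP 0 (complex.Im l); first exact.
  by apply: (IH l^* _ (pencil_root_conj rl)); case: l l0 Rl {rl} => a b //= b0 _; rewrite oppr_ge0 ltW.
have Rl0 : 0 <= complex.Re l by rewrite Rl.
have [x1 [_ [u1 [u2 [E1 Eu2 _ Eu1 u20]]]]] :=
  pencil_signals_rhp min1 min2 HSNI D12 D21 Rl0 rl.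
have [lz|lnz] := eqVneq (complex.Im l) 0.
  have {Rl0 Rl lz l0} lE : l = 0 by apply/eqP; rewrite eq_complex Rl lz !eqxx.
  have r0 : ~~ root (char_poly (cA S1)) l.
    by apply: no_pole_no_eigenvalue min1 _; rewrite lE; case: GNI => -[].
  have [_ EG] := tfeval_transfer min1.1 r0.
  have Gu : u2 = tfeval G l *m u1.
    rewrite Eu2 EG mulmxDl -!mulmxA -E1 mulKmx// unitmxE unitfE -char_poly_eval//.
  move: lam; rewrite ltNge => /negP; apply.
  have ev : tfeval G 0 *m tfeval H 0 *m u2 = (t^-1)%:C *: u2.
    rewrite -lE {2}Gu Eu1 -scalemxAr scalerA -mulmxA -rmorphM /= mulVf ?gt_eqF//.
    by rewrite scale1r.
  by apply: le_trans (lambda_max_eigenvalue u20 ev); rewrite invf_ge1.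
have w0 : 0 < complex.Im l by rewrite lt_def lnz.
have lE : l = jw (complex.Im l) by case: l Rl {rl l0 Rl0 E1 Eu1 lnz w0} => a b /= ->.
rewrite lE in E1 Eu1.
have := negative_imaginary_axis min1 GNI w0 E1; rewrite -Eu2.
have [k k0 Hk] := pd_jdiff (HSNI.2 _ w0).
(* Im (u1* u2) = - t Im (u2* H u2): conjugation flips the sign. *)
rewrite dotC Im_conjc Eu1 dotZr Im_realM oppr_le0 leNgt => /negP; apply.
rewrite pmulr_rlt0// (le_lt_trans (Hk u2))// oppr_lt0 mulr_gt0// exprn_gt0//.
by rewrite mxn_gt0.
Qed.

End Interconnection.

(** * Eigenvalues near an imaginary pole for small t *)

Section SmallGain.
Variables (R : realType) (m : nat).
Local Notation C := R[i].
Implicit Types G H : tfmx R m.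

(** Because h |W|^2 = (h W) conj W, with h W real and nonnegative. *)
Lemma Re_le0_of_mul (h W : C) : 0 <= h * W -> complex.Re W < 0 -> complex.Re h <= 0.
Proof.
case: h W => a b [c d]; rewrite lecE /= => /andP[/eqP Eim re] c0.
rewrite leNgt; apply/negP => a0.
have : a * (c ^+ 2 + d ^+ 2) = c * (a * c - b * d) + d * (a * d + b * c) by ring.
rewrite Eim mulr0 addr0.
have : 0 < a * (c ^+ 2 + d ^+ 2).
  by rewrite mulr_gt0// ltr_pwDl ?sqr_ge0// exprn_even_gt0//= lt_eqF.
nra.
Qed.

(* With K the residue of G at p := jw w, the signals at z satisfy
   (z - p) (u2 - e1) = t K w1, where w1 is close to H(p) u2 and e1 = O(t).
   As p K >= 0 and Im (u2* H(p) u2) < 0, this forces Re z <= 0. *)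
Lemma pencil_near_pole G H n1 n2 (S1 : state_space R n1 m) (S2 : state_space R n2 m)
    (w : R) :
  minimal_realization G S1 -> minimal_realization H S2 ->
  negative_imaginary G -> strictly_negative_imaginary H ->
  cD S1 *m cD S2 = 0 -> cD S2 *m cD S1 = 0 ->
  0 < w -> root (char_poly (cA S1)) (jw w) ->
  exists2 d : R, 0 < d & forall (t : R) z, 0 < t < d ->
    root (char_poly (pencil0 S1 S2 + t%:C *: pencil1 S1 S2)) z ->
    cmod (z - jw w) < d -> complex.Re z <= 0.
Proof.
move=> min1 min2 GNI HSNI D12 D21 w0 rw.
have [P [T [PA TA [_ Kpsd]]]] := residue_psd min1 GNI w0 rw.
set p := jw w in rw PA TA Kpsd *.
have [k k0 Hk] := pd_jdiff (HSNI.2 w w0); rewrite -/p in Hk.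
have r2 : ~~ root (char_poly (cA S2)) p by apply: sni_regular min2 HSNI _; rewrite lexx.
have U2 : p%:M - cA S2 \in unitmx by rewrite unitmxE unitfE -char_poly_eval.
(* H is regular at p, so the resolvent lemmas apply to it with P = 0 and T = V. *)
pose V := invmx (p%:M - cA S2).
have VA : V *m (p%:M - cA S2) = 1%:M - 0 by rewrite subr0 mulVmx.
have [_ EH] := tfeval_transfer min2.1 r2; rewrite -/V in EH.
set Hp := tfeval H p in Hk EH.
pose cT := mxn T + 2 * mxn T * (mxn P + mxn T).
pose cV := mxn V + 2 * mxn V * (mxn (0 : 'M[C]_n2) + mxn V).
have cT0 : 0 <= cT by rewrite addr_ge0 ?mulr_ge0 ?addr_ge0 ?mxn_ge0.
have cV0 : 0 <= cV by rewrite addr_ge0 ?mulr_ge0 ?addr_ge0 ?mxn_ge0.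
pose c1 := mxn (cC S1) * (cT * mxn (cB S1)) + mxn (cD S1).
pose c3 := mxn (cC S2) * (mxn V * (cV * mxn (cB S2))).
pose c4 := mxn Hp + c3.
have c10 : 0 <= c1 by rewrite addr_ge0 ?mulr_ge0 ?mxn_ge0.
have c30 : 0 <= c3 by rewrite !mulr_ge0 ?mxn_ge0.
have c40 : 0 <= c4 by rewrite addr_ge0 ?mxn_ge0.
(* The margin k loses |h| c3 from moving H off p and t c1 c4^2 from [e1]; with |h| and t below k /
   c5 the total loss stays below k. *)
pose c5 := c3 + c1 * c4 ^+ 2 + 1.
have c50 : 0 < c5 by rewrite ltr_wpDl// addr_ge0// mulr_ge0// sqr_ge0.
pose T1 := 2 * mxn T + 2 * mxn V + 1.
have T10 : 0 < T1 by rewrite ltr_wpDl// addr_ge0// mulr_ge0// mxn_ge0.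
exists (Num.min 1 (Num.min T1^-1 (k / c5))).
  by rewrite !lt_min ltr01 invr_gt0 T10 divr_gt0.
move=> t z /andP[t0]; rewrite !lt_min => /and3P[t1 _ tk] rz /and3P[h1 hT hk].
rewrite leNgt; apply/negP => z0.
have [x1 [x2 [u1 [u2 [E1 Eu2 [E2 Ew] Eu1 u20]]]]] :=
  pencil_signals_rhp min1 min2 HSNI D12 D21 (ltW z0) rz.
rewrite -Ew in Eu1; set w1 := cC S2 *m x2 + cD S2 *m u2 in Eu1 Ew.
set h := z - p in h1 hT hk.
have h0 : h != 0.
  apply: contraTneq z0 => /eqP; rewrite subr_eq0 => /eqP ->.
  by rewrite /= ltxx.
have {}hT : cmod h * (mxn T + mxn V) <= 2^-1.
  move: hT; rewrite -[_^-1]mul1r ltr_pdivlMr// /T1.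
  by have := cmod_ge0 h; have := mxn_ge0 T; have := mxn_ge0 V; nra.
have hT1 : cmod h * mxn T <= 2^-1.
  by rewrite (le_trans _ hT)// ler_wpM2l ?cmod_ge0// lerDl mxn_ge0.
have hV : cmod h * mxn V <= 2^-1.
  by rewrite (le_trans _ hT)// ler_wpM2l ?cmod_ge0// lerDr mxn_ge0.
have [Y1 [hx1 Y1b]] := resolvent_near_pole_bound PA TA E1 (ltW h1) hT1.
have [Y2 [hx2 Y2b]] := resolvent_near_pole_bound (mul0mx _ _) VA E2 (ltW h1) hV.
have [_] := resolvent_near_pole (mul0mx _ _) VA E2.
rewrite mul0mx add0r => x2E.
have {hx2} xY : x2 = Y2.
  by move: hx2; rewrite mul0mx add0r; exact: (scalerI h0).
pose e2 := cC S2 *m (V *m x2).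
have w1E : w1 = Hp *m u2 - h *: e2.
  rewrite /w1 {1}x2E EH mulmxBr mulmxDl !mulmxA addrAC; congr (_ - _).
  by rewrite -scalemxAr /e2 !mulmxA.
have e2b : mxn e2 <= c3 * mxn u2.
  rewrite /c3 -!mulrA (le_trans (mxnM _ _))// ler_wpM2l ?mxn_ge0//.
  rewrite (le_trans (mxnM _ _))// ler_wpM2l ?mxn_ge0// xY (le_trans Y2b)//.
  by rewrite ler_wpM2l ?mxnM.
pose e1 := cC S1 *m Y1 + cD S1 *m u1.
have e1b : mxn e1 <= c1 * mxn u1.
  rewrite /c1 mulrDl (le_trans (mxnD _ _))// lerD ?mxnM// -!mulrA.
  rewrite (le_trans (mxnM _ _))// ler_wpM2l ?mxn_ge0// (le_trans Y1b)//.
  by rewrite ler_wpM2l ?mxnM.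
have w1b : mxn w1 <= c4 * mxn u2.
  rewrite w1E (le_trans (mxnB _ _))// mulrDl lerD ?mxnM// mxnZ.
  by rewrite -[leRHS]mul1r ler_pM ?cmod_ge0 ?mxn_ge0// ltW.
have u1b : mxn u1 = t * mxn w1 by rewrite Eu1 mxnZ cmod_real gtr0_norm.
pose q := dot w1 u2 - dot w1 e1.
have hq : 0 <= h * (p * q).
  have -> : h * (p * q) = t%:C * dot w1 ((p *: (cC S1 *m P *m cB S1)) *m w1).
    rewrite /q -dotBr -!dotZr; congr dot.
    (* h (x1 - Y1) = P B1 u1, which isolates the polar part of the output of G. *)
    have -> : u2 - e1 = cC S1 *m (x1 - Y1) by rewrite Eu2 /e1 mulmxBr opprD addrACA subrr addr0.
    rewrite scalerA mulrC -scalerA scalemxAr scalerBr hx1 addrK Eu1 -!scalemxAr.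
    by rewrite -scalemxAl !scalerA mulrC !mulmxA.
  by rewrite mulr_ge0// ?ler0c ?(ltW t0)// /dot mulmxA; exact: Kpsd.
(* As p = jw, this says Im q > 0; the main term is Im (w1* u2) = - Im (u2* w1), at least k |u2|^2 up
   to the losses. *)
have ReW : complex.Re (p * q) < 0.
  have -> : complex.Re (p * q) = - (w * complex.Im q) by case: (q) => a b /=; ring.
  rewrite oppr_lt0 mulr_gt0// /q raddfB /= subr_gt0.
  have u2n : 0 < mxn u2 by rewrite mxn_gt0.
  have bound1 : complex.Im (dot w1 e1) <= c1 * c4 ^+ 2 * t * mxn u2 ^+ 2.
    rewrite (le_trans (ler_norm _))// (le_trans (Im_le_cmod _))// (le_trans (cmod_dot _ _))//.
    rewrite (@le_trans _ _ ((c4 * mxn u2) * (c1 * (t * (c4 * mxn u2)))))//.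
      rewrite ler_pM ?mxn_ge0// (le_trans e1b)// u1b.
      by rewrite ler_wpM2l// ler_wpM2l ?(ltW t0).
    by rewrite le_eqVlt; apply/orP; left; apply/eqP; ring.
  have bound2 : k * mxn u2 ^+ 2 - cmod h * c3 * mxn u2 ^+ 2 <= complex.Im (dot w1 u2).
    have e2n : - complex.Im (h * dot u2 e2) <= cmod h * c3 * mxn u2 ^+ 2.
      rewrite (le_trans (ler_norm _))// normrN (le_trans (Im_le_cmod _))// cmodM -mulrA.
      rewrite ler_wpM2l ?cmod_ge0// (le_trans (cmod_dot _ _))// mulrC expr2 mulrA.
      by rewrite ler_wpM2r ?mxn_ge0.
    rewrite dotC Im_conjc w1E dotBr dotZr raddfB /= opprD.
    by rewrite lerB// ?opprK// lerNr.
  apply: le_lt_trans bound1 _; apply: lt_le_trans bound2.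
  rewrite -mulrBl ltr_pM2r ?exprn_gt0// ltrBrDl.
  have kc : k / c5 * c5 = k by rewrite divfK// gt_eqF.
  have c4q : 0 <= c1 * c4 ^+ 2 by rewrite mulr_ge0 ?sqr_ge0.
  have k5 : 0 < k / c5 by rewrite divr_gt0.
  rewrite -kc {2}/c5 !mulrDr mulr1.
  rewrite (@le_lt_trans _ _ (k / c5 * c3 + k / c5 * (c1 * c4 ^+ 2)))// ?ltrDl//.
  by rewrite lerD ?ler_wpM2r// ?(ltW hk)// mulrC ler_wpM2r// ltW.
by have := Re_le0_of_mul hq ReW; rewrite raddfB /= subr0 leNgt z0.
Qed.

(** At t = 0 the loop signal u1 vanishes, so x1 solves the free equation of the first system, and it
    is nonzero because u2 = C1 x1 is. *)
Lemma pencil0_root G H n1 n2 (S1 : state_space R n1 m) (S2 : state_space R n2 m) (p : C) :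
  minimal_realization G S1 -> minimal_realization H S2 ->
  strictly_negative_imaginary H ->
  cD S1 *m cD S2 = 0 -> cD S2 *m cD S1 = 0 ->
  root (char_poly (pencil0 S1 S2)) p -> 0 <= complex.Re p ->
  root (char_poly (cA S1)) p.
Proof.
move=> min1 min2 HSNI D12 D21 rp p0.
have := pencil_signals_rhp (t := 0) min1 min2 HSNI D12 D21 p0.
rewrite scale0r addr0 => /(_ rp)[x1 [_ [u1 [u2 [E1 Eu2 _ Eu1 u20]]]]].
apply/char_poly_root_col; exists x1.
  by apply: contraNneq u20 => x10; rewrite Eu2 Eu1 x10 scale0r !mulmx0 addr0.
move: E1; rewrite Eu1 scale0r mulmx0 mulmxBl mul_scalar_mx => /eqP.
by rewrite subr_eq0 eq_sym => /eqP.
Qed.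

End SmallGain.

Theorem theorem1 (R : realType) (m : nat) (G H : tfmx R m) :
  tfproper G -> negative_imaginary G ->
  tfproper H -> strictly_negative_imaginary H ->
  tfinfty G *m tfinfty H = 0 ->
  psdmx (tfinfty H) ->
  lambda_max (tfeval G 0 *m tfeval H 0) < 1 ->
  internally_stable G H.
Proof.
move=> _ GNI _ HSNI D12 _ lam n1 n2 S1 S2 min1 min2 l.
rewrite eigenvalue_root_char closed_loop_pencil.
rewrite (tfinftyE min1.1) (tfinftyE min2.1) in D12.
(* Symmetry of both feedthroughs turns D1 D2 = 0 into D2 D1 = 0 by transposition. *)
have sym1 : (cD S1)^T = cD S1.
  apply: feedthrough_sym min1.1 _ => w w0 np v.
  by case: GNI => _ N2 _; exact/psd_jdiff/N2.
have sym2 : (cD S2)^T = cD S2.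
  apply: feedthrough_sym min2.1 _ => w w0 _ v.
  have [k k0 Hk] := pd_jdiff (HSNI.2 w w0).
  by rewrite (le_trans (Hk v))// oppr_le0 mulr_ge0 ?sqr_ge0// ltW.
have D21 : cD S2 *m cD S1 = 0 by rewrite -sym1 -sym2 -trmx_mul D12 trmx0.
have [[G0 Gpos] _ _] := GNI.
apply: hurwitz_homotopy => [p rp|t z t01 rz]; last first.
  exact: (pencil_axis min1 min2 GNI HSNI D12 D21 lam t01 rz).
(* Near an eigenvalue in the open left half plane its distance to the axis is a suitable radius. *)
have [p0|p0] := ltP (complex.Re p) 0.
  exists (- complex.Re p); first by rewrite oppr_gt0.
  move=> t z _ _; have := Re_le_cmod (z - p); have := ler_norm (complex.Re (z - p)).
  by rewrite raddfB /=; lra.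
(* All other eigenvalues at t = 0 come from A1 and lie on the axis, since G has no pole in the open
   right half plane. *)
have pole (q : R[i]) : root (char_poly (pencil0 S1 S2)) q -> 0 <= complex.Re q ->
    complex.Re q = 0 /\ root (char_poly (cA S1)) q.
  move=> rq q0; have rq1 := pencil0_root min1 min2 HSNI D12 D21 rq q0; split => //.
  apply/eqP; rewrite eq_le q0 andbT leNgt; apply/negP => qpos.
  by move: rq1; apply/negP; exact: no_pole_no_eigenvalue min1 (Gpos q qpos).
have [p00 rp1] := pole p rp p0.
case: (ltgtP (complex.Im p) 0) => [pneg|ppos|pz].
- have w0 : 0 < - complex.Im p by rewrite oppr_gt0.
  have Ep : p^* = jw (- complex.Im p) by case: (p) p00 => a b /= ->.
  have rpc : root (char_poly (pencil0 S1 S2)) p^*.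
    have := @pencil_root_conj _ _ _ _ S1 S2 0 p.
    by rewrite scale0r addr0; exact.
  have [|_ rpc1] := pole _ rpc; first by rewrite Ep.
  rewrite Ep in rpc1.
  have [d d0 Hd] := pencil_near_pole min1 min2 GNI HSNI D12 D21 w0 rpc1.
  exists d => // t z td rz zd.
  have -> : complex.Re z = complex.Re z^* by case: (z).
  apply: (Hd t _ td (pencil_root_conj rz)).
  by rewrite -Ep -rmorphB cmod_conj.
- have Ep : p = jw (complex.Im p) by case: (p) p00 => a b /= ->.
  by rewrite Ep in rp1; rewrite Ep; exact: (pencil_near_pole min1 min2 GNI HSNI D12 D21 ppos rp1).
- exfalso; move: rp1; have -> : p = 0 by apply/eqP; rewrite eq_complex p00 pz !eqxx.
  by apply/negP; exact: no_pole_no_eigenvalue min1 G0.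
Qed.
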